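(* Let $\mathfrak{C}$ be an $(\!(n,k)\!)$ code with isometric encoding channel $\mathcal E$, let $d\ge1$, $\delta\ge0$, and let $\mathsf g$ be the complete graph on the $n$ qubits. Suppose either $$H_2\big(\varepsilon_{\mathsf g}(\mathfrak{C},d)/2+\delta/2\big)<k/n,$$ or $$H_2\big(2\max_{\mathcal N}\tilde\varepsilon(\mathcal N,\mathcal E)+\delta/2\big)<k/n,$$ where the maximum is over all replacement channels $\mathcal N$ acting on any $d$ qubits, and where the arguments of $H_2$ are less than $1/2$. Then every code state $|\psi\rangle\in\mathfrak{C}$ satisfies $\mathscr{C}^{\delta}(\psi)>\log d$.
   Context: An $(\!(n,k)\!)$ code is a $2^k$-dimensional subspace $\mathfrak{C}\subseteq(\mathbb{C}^2)^{\otimes n}$, $k<n$; $\Gamma=\Pi/2^k$. $\varepsilon_{\mathsf g}(\mathfrak{C},d)=\max\{\|\psi_S-\Gamma_S\|_1:|\psi\rangle\in\mathfrak{C}, |S|\le d\}$. A replacement channel on a set $S$ of qubits is $\sigma\mapsto(\mathrm{Tr}_S\sigma)\otimes\gamma$ for fixed $\gamma$ (identity elsewhere). QEC inaccuracy $\tilde\varepsilon(\mathcal N,\mathcal E)=\min_{\mathcal R}P(\mathcal R\circ\mathcal N\circ\mathcal E,\mathrm{id}_L)$, where $P(\mathcal M_1,\mathcal M_2)=\sqrt{1-F^2}$, $F=\min_\rho f((\mathcal M_1\otimes\mathrm{id})(\rho),(\mathcal M_2\otimes\mathrm{id})(\rho))$, $f(\rho,\sigma)=\|\sqrt\rho\sqrt\sigma\|_1$.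 $\mathscr{C}^\delta(\psi)$ is the minimum over pure $\psi'$ with $\|\psi'-\psi\|_1\le\delta$ of the minimum depth of a circuit of layers of disjoint arbitrary 2-qubit gates preparing $|\psi'\rangle$ from $|0\rangle^{\otimes n}$. Logs base 2; $H_2$ binary entropy. *)

(* Defs.v *)
From HB Require Import structures.
From Stdlib Require Import ClassicalEpsilon.
From mathcomp Require Import all_boot all_order all_algebra.
From mathcomp Require Import complex.
From mathcomp Require Import boolp classical_sets reals constructive_ereal ereal exp.

Set Implicit Arguments.
Unset Strict Implicit.
Unset Printing Implicit Defensive.
Import Order.TTheory GRing.Theory Num.Theory.
Local Open Scope ring_scope.
Local Open Scope classical_set_scope.

Section QInfo.
Variable R : realType.
Local Notation C := (R[i]).

Definition mat (X Y : finType) := X -> Y -> C.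
Definition vec (X : finType) := X -> C.

Definition mmul (X Y Z : finType) (A : mat X Y) (B : mat Y Z) : mat X Z :=
  fun x z => \sum_(y : Y) A x y * B y z.
Definition mapply (X Y : finType) (A : mat X Y) (v : vec Y) : vec X :=
  fun x => \sum_(y : Y) A x y * v y.
Definition adj (X Y : finType) (A : mat X Y) : mat Y X :=
  fun y x => Num.conj (A x y).
Definition msub (X Y : finType) (A B : mat X Y) : mat X Y := fun x y => A x y - B x y.
Definition mscale (X Y : finType) (c : C) (A : mat X Y) : mat X Y := fun x y => c * A x y.
Definition madd (X Y : finType) (A B : mat X Y) : mat X Y := fun x y => A x y + B x y.
Definition idm (X : finType) : mat X X := fun x y => (x == y)%:R.
Definition mtr (X : finType) (A : mat X X) : C := \sum_(x : X) A x x.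

Definition psd (X : finType) (A : mat X X) : Prop :=
  forall v : vec X, 0 <= \sum_(x : X) \sum_(y : X) Num.conj (v x) * A x y * v y.
Definition density (X : finType) (rho : mat X X) : Prop := psd rho /\ mtr rho = 1.
Definition qisometry (X Y : finType) (V : mat X Y) : Prop :=
  forall y y', mmul (adj V) V y y' = @idm Y y y'.
Definition qunitary (X : finType) (U : mat X X) : Prop :=
  qisometry U /\ (forall x x', mmul U (adj U) x x' = @idm X x x').
Definition unit_vec (X : finType) (v : vec X) : Prop :=
  \sum_(x : X) Num.conj (v x) * v x = 1.
Definition proj (X : finType) (v : vec X) : mat X X := fun x y => v x * Num.conj (v y).

(* the positive square root of a psd operator (the unique psd P with P P = A) *)
Definition msqrt (X : finType) (A : mat X X) : mat X X :=
  epsilon (inhabits (fun _ _ => 0 : C))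
    (fun P : mat X X => psd P /\ (forall x y, mmul P P x y = A x y)).

Definition trnorm (X Y : finType) (A : mat X Y) : R :=
  complex.Re (mtr (msqrt (mmul (adj A) A))).

Definition fid (X : finType) (rho sigma : mat X X) : R :=
  trnorm (mmul (msqrt rho) (msqrt sigma)).

Definition chan (X Y : finType) := mat X X -> mat Y Y.

(* (M \otimes id_Z) *)
Definition ext (X Y Z : finType) (M : chan X Y) (rho : mat (X * Z)%type (X * Z)%type)
  : mat (Y * Z)%type (Y * Z)%type :=
  fun p q => M (fun x x' => rho (x, p.2) (x', q.2)) p.1 q.1.

Definition cptp (X Y : finType) (M : chan X Y) : Prop :=
  (forall (c : C) (A B : mat X X) y y',
      M (madd (mscale c A) B) y y' = c * M A y y' + M B y y') /\
  (forall A : mat X X, mtr (M A) = mtr A) /\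
  (forall (Z : finType) (rho : mat (X * Z)%type (X * Z)%type), psd rho -> psd (ext M rho)).

Definition chan_fid (X Y : finType) (M1 M2 : chan X Y) : R :=
  inf [set fid (ext M1 rho) (ext M2 rho) | rho in [set rho : mat (X * X)%type (X * X)%type | density rho]].

Definition pdist (X Y : finType) (M1 M2 : chan X Y) : R :=
  Num.sqrt (1 - chan_fid M1 M2 ^+ 2).

Definition qec_inacc (L P : finType) (N : chan P P) (E : chan L P) : R :=
  inf [set pdist (fun rho => Rc (N (E rho))) (fun rho => rho)
      | Rc in [set Rc : chan P L | cptp Rc]].

Definition qb (n : nat) := {ffun 'I_n -> bool}.
Definition subq (n : nat) (S : {set 'I_n}) := {ffun {i : 'I_n | i \in S} -> bool}.
Definition restr (n : nat) (S : {set 'I_n}) (x : qb n) : subq S :=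
  [ffun i => x (val i)].
Arguments restr {n} S x.

(* reduced operator on S : partial trace over the complement of S *)
Definition ptr (n : nat) (S : {set 'I_n}) (rho : mat (qb n) (qb n)) : mat (subq S) (subq S) :=
  fun a b => \sum_(x : qb n) \sum_(y : qb n)
    ([&& restr S x == a, restr S y == b & [forall i, (i \notin S) ==> (x i == y i)]])%:R
      * rho x y.
Arguments ptr {n} S rho _ _.

Definition repl (n : nat) (S : {set 'I_n}) (gamma : mat (subq S) (subq S)) : chan (qb n) (qb n) :=
  fun rho x y => ptr (~: S) rho (restr (~: S) x) (restr (~: S) y) * gamma (restr S x) (restr S y).

Definition enc (k n : nat) (V : mat (qb n) (qb k)) : chan (qb k) (qb n) :=
  fun rho => mmul (mmul V rho) (adj V).

Definition code_state (k n : nat) (V : mat (qb n) (qb k)) (psi : vec (qb n)) : Prop :=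
  exists phi : vec (qb k), unit_vec phi /\ psi = mapply V phi.

Definition Gam (k n : nat) (V : mat (qb n) (qb k)) : mat (qb n) (qb n) :=
  mscale (2 ^+ k)^-1 (mmul V (adj V)).

(* epsilon_g(C,d) for g the complete graph: max over code states and |S| <= d *)
Definition eps_g (k n : nat) (V : mat (qb n) (qb k)) (d : nat) : R :=
  sup [set r : R | exists (psi : vec (qb n)) (S : {set 'I_n}),
      code_state V psi /\ (#|S| <= d)%N /\
      r = trnorm (msub (ptr S (proj psi)) (ptr S (Gam V)))].

Definition max_repl_inacc (k n : nat) (V : mat (qb n) (qb k)) (d : nat) : R :=
  sup [set r : R | exists (S : {set 'I_n}) (gamma : mat (subq S) (subq S)),
      (#|S| <= d)%N /\ density gamma /\ r = qec_inacc (repl gamma) (enc V)].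

Definition covered (n : nat) (P : {set ('I_n * 'I_n)%type}) (q : 'I_n) : bool :=
  [exists p in P, (p.1 == q) || (p.2 == q)].

Definition valid_pairs (n : nat) (P : {set ('I_n * 'I_n)%type}) : Prop :=
  (forall p, p \in P -> p.1 != p.2) /\
  (forall p p', p \in P -> p' \in P -> p != p' ->
     [&& p.1 != p'.1, p.1 != p'.2, p.2 != p'.1 & p.2 != p'.2]).

Definition layer_op (n : nat) (P : {set ('I_n * 'I_n)%type})
  (U : ('I_n * 'I_n)%type -> mat (bool * bool)%type (bool * bool)%type) : mat (qb n) (qb n) :=
  fun x y => (\prod_(p in P) U p (x p.1, x p.2) (y p.1, y p.2))
             * ([forall q, (~~ covered P q) ==> (x q == y q)])%:R.

Definition is_layer (n : nat) (L : mat (qb n) (qb n)) : Prop :=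
  exists (P : {set ('I_n * 'I_n)%type}) (U : ('I_n * 'I_n)%type -> mat (bool * bool)%type (bool * bool)%type),
    valid_pairs P /\ (forall p, p \in P -> qunitary (U p)) /\
    (forall x y, L x y = layer_op P U x y).

Definition zero_state (n : nat) : vec (qb n) := fun x => (x == [ffun => false])%:R.

Definition run (n : nat) (c : seq (mat (qb n) (qb n))) : vec (qb n) :=
  foldr (fun L v => mapply L v) (@zero_state n) c.

(* delta-approximate circuit complexity C^delta(psi) (in extended reals, +oo if no circuit) *)
Definition circ_cplx (n : nat) (delta : R) (psi : vec (qb n)) : \bar R :=
  ereal_inf [set ((size c)%:R)%:E
    | c in [set c : seq (mat (qb n) (qb n)) | (forall L, L \in c -> is_layer L) /\
             trnorm (msub (proj (run c)) (proj psi)) <= delta]].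

Definition log2 (x : R) : R := ln x / ln 2.
Definition H2 (p : R) : R := - p * log2 p - (1 - p) * log2 (1 - p).

End QInfo.

(* Main.v *)
Require Import Defs.
From HB Require Import structures.
From Stdlib Require Import ClassicalEpsilon.
From mathcomp Require Import all_boot all_order all_algebra.
From mathcomp Require Import complex.
From mathcomp Require Import boolp classical_sets reals constructive_ereal ereal exp.
From mathcomp Require Import ring lra.
Import Order.TTheory GRing.Theory Num.Theory.
Set Implicit Arguments.
Unset Strict Implicit.
Unset Printing Implicit Defensive.
Local Open Scope ring_scope.

(** Let [U] be a circuit of depth at most [log d] with [U |0>] close to the code state
    [psi], and let [W_i = U Z_i U^*]. Each [W_i] is a reflection supported on a light cone
    of at most [d] qubits and has expectation 1 in [U |0>], so its expectation in [Gam] is at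
    least [1 - 2 q], where [q] is the argument of [H2]. Hence the distribution
    [p x = <x| U^* Gam U |x>] has all its one-bit marginals at most [q]; since
    [p x <= 2 ^- k] pointwise, Gibbs' inequality against the product of Bernoulli([q])
    distributions gives [k <= n H2 q].

    In the first case the expectations of [W_i] in [psi] and [Gam] are compared by the duality
    [Re Tr (W A) <= |A|_1]. In the second case, recovery is tested on an entangled input with
    Schmidt weight 1/2 on the logical state of [psi], the other 1/2 being spread evenly over
    its complement. The recovered pair is nearly the pure input state, hence nearly
    uncorrelated with the lost qubits [S]; but the correlation of [W_i] on [S] with a sign
    observable on the reference is a multiple of [Tr W_i (psi - Gam)]. Choosing the input
    according to [psi] avoids any minimax argument. *)

Local Notation "A ** B" := (mmul A B) (at level 40, left associativity).
Local Notation Re := complex.Re.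
(* [rat] also defines a [subq]. *)
Local Notation subq := Defs.subq.

(** * Matrices over finite types *)

Section MatAlgebra.
Variable R : realType.
Local Notation C := (R[i]).
Local Notation mone X := (@idm R X).

Lemma mat_ext (X Y : finType) (A B : mat R X Y) : (forall x y, A x y = B x y) -> A = B.
Proof. by move=> AB; apply/funext => x; apply/funext => y. Qed.

Lemma sum_eq_mull (X : finType) (x : X) (f : X -> C) : \sum_y (x == y)%:R * f y = f x.
Proof.
rewrite (bigD1 x) //= eqxx mul1r big1 ?addr0 // => y /negPf yx.
by rewrite eq_sym yx mul0r.
Qed.

Lemma sum_eq_mulr (X : finType) (x : X) (f : X -> C) : \sum_y f y * (y == x)%:R = f x.
Proof. by rewrite -[RHS](sum_eq_mull x); apply: eq_bigr => y _; rewrite mulrC eq_sym. Qed.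

Lemma mmulA (X Y Z T : finType) (A : mat R X Y) (B : mat R Y Z) (D : mat R Z T) :
  A ** (B ** D) = A ** B ** D.
Proof.
apply: mat_ext => x t; rewrite /mmul.
under eq_bigr do rewrite mulr_sumr.
rewrite exchange_big /=; apply: eq_bigr => z _; rewrite mulr_suml.
by apply: eq_bigr => y _; rewrite mulrA.
Qed.

Lemma mmulDl (X Y Z : finType) (A B : mat R X Y) (D : mat R Y Z) :
  madd A B ** D = madd (A ** D) (B ** D).
Proof.
by apply: mat_ext => x z; rewrite /mmul /madd -big_split; apply: eq_bigr => y _; rewrite mulrDl.
Qed.

Lemma mmulDr (X Y Z : finType) (A B : mat R Y Z) (D : mat R X Y) :
  D ** madd A B = madd (D ** A) (D ** B).
Proof.
by apply: mat_ext => x z; rewrite /mmul /madd -big_split; apply: eq_bigr => y _; rewrite mulrDr.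
Qed.

Lemma mmulBl (X Y Z : finType) (A B : mat R X Y) (D : mat R Y Z) :
  msub A B ** D = msub (A ** D) (B ** D).
Proof.
by apply: mat_ext => x z; rewrite /mmul /msub -sumrB; apply: eq_bigr => y _; rewrite mulrBl.
Qed.

Lemma mmulBr (X Y Z : finType) (A B : mat R Y Z) (D : mat R X Y) :
  D ** msub A B = msub (D ** A) (D ** B).
Proof.
by apply: mat_ext => x z; rewrite /mmul /msub -sumrB; apply: eq_bigr => y _; rewrite mulrBr.
Qed.

Lemma mmulZl (X Y Z : finType) c (A : mat R X Y) (D : mat R Y Z) :
  mscale c A ** D = mscale c (A ** D).
Proof.
by apply: mat_ext => x z; rewrite /mmul /mscale mulr_sumr; apply: eq_bigr => y _; rewrite mulrA.
Qed.

Lemma mmulZr (X Y Z : finType) c (A : mat R X Y) (D : mat R Y Z) :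
  A ** mscale c D = mscale c (A ** D).
Proof.
by apply: mat_ext => x z; rewrite /mmul /mscale mulr_sumr; apply: eq_bigr => y _; rewrite mulrCA.
Qed.

Lemma mmul1m (X Y : finType) (A : mat R X Y) : mone X ** A = A.
Proof. by apply: mat_ext => x y; rewrite /mmul /idm sum_eq_mull. Qed.

Lemma mmulm1 (X Y : finType) (A : mat R X Y) : A ** mone Y = A.
Proof. by apply: mat_ext => x y; rewrite /mmul /idm sum_eq_mulr. Qed.

Lemma adjK (X Y : finType) (A : mat R X Y) : adj (adj A) = A.
Proof. by apply: mat_ext => x y; rewrite /adj conjCK. Qed.

Lemma adjM (X Y Z : finType) (A : mat R X Y) (B : mat R Y Z) : adj (A ** B) = adj B ** adj A.
Proof.
apply: mat_ext => z x; rewrite /adj /mmul rmorph_sum; apply: eq_bigr => y _.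
by rewrite rmorphM mulrC.
Qed.

Lemma adjB (X Y : finType) (A B : mat R X Y) : adj (msub A B) = msub (adj A) (adj B).
Proof. by apply: mat_ext => x y; rewrite /adj /msub rmorphB. Qed.

Lemma adjD (X Y : finType) (A B : mat R X Y) : adj (madd A B) = madd (adj A) (adj B).
Proof. by apply: mat_ext => x y; rewrite /adj /madd rmorphD. Qed.

Lemma adjZ (X Y : finType) c (A : mat R X Y) : adj (mscale c A) = mscale (Num.conj c) (adj A).
Proof. by apply: mat_ext => x y; rewrite /adj /mscale rmorphM. Qed.

Lemma adj_idm (X : finType) : adj (mone X) = mone X.
Proof. by apply: mat_ext => x y; rewrite /adj /idm rmorph_nat eq_sym. Qed.

Lemma adj_proj (X : finType) (v : vec R X) : adj (proj v) = proj v.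
Proof. by apply: mat_ext => x y; rewrite /adj /proj rmorphM /= conjCK mulrC. Qed.

Lemma mtrC (X Y : finType) (A : mat R X Y) (B : mat R Y X) : mtr (A ** B) = mtr (B ** A).
Proof.
rewrite /mtr /mmul exchange_big; apply: eq_bigr => y _; apply: eq_bigr => x _.
by rewrite mulrC.
Qed.

Lemma mtrD (X : finType) (A B : mat R X X) : mtr (madd A B) = mtr A + mtr B.
Proof. by rewrite /mtr -big_split. Qed.

Lemma mtrB (X : finType) (A B : mat R X X) : mtr (msub A B) = mtr A - mtr B.
Proof. by rewrite /mtr -sumrB. Qed.

Lemma mtrZ (X : finType) c (A : mat R X X) : mtr (mscale c A) = c * mtr A.
Proof. by rewrite /mtr mulr_sumr. Qed.

Lemma qisometryE (X Y : finType) (V : mat R X Y) : qisometry V -> adj V ** V = mone Y.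
Proof. by move=> VV; apply: mat_ext. Qed.

Lemma mtr_proj_mul (X : finType) (A : mat R X X) (v : vec R X) :
  mtr (A ** proj v) = \sum_x \sum_y Num.conj (v x) * A x y * v y.
Proof.
rewrite /mtr /mmul /proj; apply: eq_bigr => x _; apply: eq_bigr => y _.
by rewrite mulrA mulrC mulrA.
Qed.

Lemma unit_vec_delta (X : finType) (x0 : X) : unit_vec (fun x => (x == x0)%:R : C).
Proof.
rewrite /unit_vec -[RHS](sum_eq_mulr x0 (fun=> 1)).
by apply: eq_bigr => x _; rewrite conjC_nat mul1r -natrM mulnb andbb.
Qed.

Lemma proj_idem (X : finType) (v : vec R X) : unit_vec v -> proj v ** proj v = proj v.
Proof.
move=> v1; apply: mat_ext => x y; rewrite /mmul /proj.
under eq_bigr do rewrite -mulrA (mulrA (Num.conj _)).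
by rewrite -mulr_sumr -mulr_suml v1 mul1r.
Qed.

Lemma Re_ge0 (z : C) : 0 <= z -> 0 <= Re z.
Proof. by rewrite lecE => /andP[]. Qed.

Lemma Re_sum (I : Type) (r : seq I) (P : pred I) (F : I -> C) :
  Re (\sum_(i <- r | P i) F i) = \sum_(i <- r | P i) Re (F i).
Proof. by elim/big_rec2: _ => // i x y _ <-; case: (F i) y => [? ?] [? ?]. Qed.

Lemma ReD (x y : C) : Re (x + y) = Re x + Re y.
Proof. by case: x y => [? ?] [? ?]. Qed.

Lemma ReB (x y : C) : Re (x - y) = Re x - Re y.
Proof. by case: x y => [? ?] [? ?]. Qed.

Lemma ReZ (c : R) (z : C) : Re (c%:C%C * z) = c * Re z.
Proof. by case: z => a b /=; rewrite mul0r subr0. Qed.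

Lemma conjcE (z : C) : Num.conj z = conjc z.
Proof. by []. Qed.

Lemma Re_conjc (z : C) : Re (Num.conj z) = Re z.
Proof. by rewrite conjcE; case: z. Qed.

Lemma conj_realc (c : R) : Num.conj (c%:C%C : C) = c%:C%C.
Proof. by rewrite conjcE conjc_real. Qed.

Lemma ge0_ReK (z : C) : 0 <= z -> (Re z)%:C%C = z.
Proof. by move=> z0; apply: RRe_real; rewrite realE z0. Qed.

Lemma mtr_adj (X : finType) (A : mat R X X) : mtr (adj A) = Num.conj (mtr A).
Proof. by rewrite /mtr rmorph_sum. Qed.

(** The trace of [K rho K^*] is a sum of values of the form of [rho] at the conjugated rows of [K].
    Positivity is mostly applied in this shape, as the second moment of [K] in the state [rho]. *)
Lemma psd_gram_trace (X Y : finType) (rho : mat R X X) (K : mat R Y X) :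
  psd rho -> 0 <= mtr (adj K ** K ** rho).
Proof.
move=> rho0; rewrite -mmulA mtrC /mtr; apply: sumr_ge0 => y _.
have := rho0 (fun x => Num.conj (K y x)); congr (_ <= _).
rewrite -mmulA /mmul; apply: eq_bigr => x _; rewrite mulr_sumr; apply: eq_bigr => z _.
by rewrite conjCK mulrA.
Qed.

Lemma psd_proj (X : finType) (v : vec R X) : psd (proj v).
Proof.
move=> w; have -> : \sum_x \sum_y Num.conj (w x) * proj v x y * w y =
    (\sum_x Num.conj (w x) * v x) * Num.conj (\sum_x Num.conj (w x) * v x).
  rewrite rmorph_sum mulr_suml; apply: eq_bigr => x _; rewrite mulr_sumr.
  by apply: eq_bigr => y _; rewrite /proj rmorphM /= conjCK !mulrA mulrAC.
exact: mul_conjC_ge0.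
Qed.

(** Polarization: over the complex numbers a nonnegative form is real, and its values at
    combinations of two basis vectors with coefficients [1] and ['i] determine the off-diagonal
    entries. *)
Lemma psd_adj (X : finType) (P : mat R X X) : psd P -> adj P = P.
Proof.
move=> P0.
have form (x y : X) (c : C) :
    0 <= (P x x + c * P x y) + Num.conj c * (P y x + c * P y y).
  have := P0 (fun a => (a == x)%:R + c * (a == y)%:R); congr (_ <= _).
  have inner a : \sum_b Num.conj ((a == x)%:R + c * (a == y)%:R) * P a b *
       ((b == x)%:R + c * (b == y)%:R) =
     (P a x + c * P a y) * (a == x)%:R + Num.conj c * (P a x + c * P a y) * (a == y)%:R.
    under eq_bigr do rewrite -mulrA mulrDr.
    rewrite -mulr_sumr big_split /= sum_eq_mulr.
    under eq_bigr do rewrite mulrA.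
    rewrite sum_eq_mulr rmorphD rmorphM !rmorph_nat; ring.
  by under eq_bigr do rewrite inner; rewrite big_split /= !sum_eq_mulr.
have conj_form x y c := CrealP (ger0_real (form x y c)).
have conj_diag x : Num.conj (P x x) = P x x.
  by have := conj_form x x 0; rewrite rmorph0 !mul0r !addr0.
apply: mat_ext => x y; rewrite /adj.
have h1 := conj_form y x 1; have hi := conj_form y x 'i.
rewrite !(rmorphD, rmorphM) /= ?(rmorph1, rmorphN, conjCi, opprK, conjCK, conj_diag) /= ?(conjCi, opprK) in h1 hi.
have i2 : 'i * 'i + 1 = 0 :> C by rewrite -expr2 sqrCi addNr.
apply: (@mulfI _ 2) => //; apply/eqP; rewrite -subr_eq0; apply/eqP.
move/eqP: h1; rewrite -subr_eq0 => /eqP h1; move/eqP: hi; rewrite -subr_eq0 => /eqP hi.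
move: h1 hi i2.
set a := Num.conj (P y x); set b := Num.conj (P x y); set i := 'i => h1 hi i2.
(* The zeros stand for the relations [h1], [hi] and [i2]: the difference to be killed is
   [h1 + i * hi] plus a multiple of [i * i + 1]. *)
transitivity (0 + i * 0 + 0 * (a - b + P y x - P x y)); last by rewrite mul0r mulr0 !addr0.
rewrite -{1}h1 -{1}hi -{1}i2; ring.
Qed.

(** * Spectral decomposition of positive matrices *)

Definition diagm (X : finType) (p : X -> R) : mat R X X := fun x y => (p x)%:C%C * (x == y)%:R.

(** Bridge to matrices indexed by ordinals, for which the spectral theorem is available. *)
Definition mat_of_mx (X : finType) (A : 'M[C]_#|X|) : mat R X X :=
  fun x y => A (enum_rank x) (enum_rank y).

Lemma mat_of_mxM (X : finType) (A B : 'M[C]_#|X|) :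
  mat_of_mx (A *m B) = mat_of_mx A ** mat_of_mx B.
Proof.
apply: mat_ext => x y; rewrite /mat_of_mx mxE (reindex (@enum_rank X)) //.
exact: onW_bij (enum_rank_bij _).
Qed.

Lemma mat_of_mx1 (X : finType) : mat_of_mx 1%:M = mone X.
Proof. by apply: mat_ext => x y; rewrite /mat_of_mx mxE (inj_eq enum_rank_inj). Qed.

Lemma mat_of_mx_adj (X : finType) (A : 'M[C]_#|X|) :
  mat_of_mx (map_mx Num.conj A^T) = adj (mat_of_mx A).
Proof. by apply: mat_ext => x y; rewrite /mat_of_mx !mxE. Qed.

Lemma psd_spectral (X : finType) (P : mat R X X) : psd P ->
  exists (E : mat R X X) (p : X -> R),
    [/\ adj E ** E = mone X, E ** adj E = mone X, forall x, 0 <= p x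
      & P = E ** diagm p ** adj E].
Proof.
move=> P0; pose M := \matrix_(i < #|X|, j < #|X|) P (enum_val i) (enum_val j).
have PE : P = mat_of_mx M by apply: mat_ext => x y; rewrite /mat_of_mx mxE !enum_rankK.
have Mherm : M \is hermsymmx.
  apply/is_hermitianmxP; rewrite expr0 scale1r; apply/matrixP => i j; rewrite !mxE.
  by rewrite -[in LHS](psd_adj P0).
have uni := spectral_unitarymx M.
have := orthomx_spectralP (hermitian_normalmx Mherm); rewrite (invmx_unitary uni) => spec.
pose E := adj (mat_of_mx (spectralmx M)).
have EaE : adj E ** E = mone X.
  by rewrite /E adjK -mat_of_mx_adj -mat_of_mxM (unitarymxP uni) mat_of_mx1.
have EEa : E ** adj E = mone X.
  rewrite /E adjK -mat_of_mx_adj -mat_of_mxM -(invmx_unitary uni).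
  by rewrite mulVmx ?mat_of_mx1 // unitarymx_unit.
pose D := mat_of_mx (diag_mx (spectral_diag M)).
have PD : P = E ** D ** adj E.
  by rewrite PE [in LHS]spec !mat_of_mxM mat_of_mx_adj /E adjK.
have DP : D = adj E ** P ** E.
  by rewrite PD !mmulA EaE mmul1m -mmulA EaE mmulm1.
have D0 x : 0 <= D x x.
  have := P0 (fun y => E y x); congr (_ <= _); rewrite DP -mmulA /mmul.
  by apply: eq_bigr => y _; rewrite mulr_sumr; apply: eq_bigr => z _; rewrite mulrA.
exists E, (fun x => Re (D x x)); split => // [x|]; first exact: Re_ge0.
rewrite [LHS]PD; congr (_ ** _ ** _); apply: mat_ext => x y.
rewrite /diagm ge0_ReK // /D /mat_of_mx !mxE (inj_eq enum_rank_inj) eqxx.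
by case: eqP => _; rewrite ?mulr1 ?mulr0.
Qed.

End MatAlgebra.

(** * Trace norm and fidelity *)

Section TraceNorm.
Variable R : realType.
Local Notation C := (R[i]).
Local Notation mone X := (@idm R X).
Local Notation mzero := (fun _ _ => 0).

Lemma psd_gram (X Y : finType) (K : mat R Y X) : psd (adj K ** K).
Proof. by move=> v; rewrite -mtr_proj_mul; apply/psd_gram_trace/psd_proj. Qed.

Lemma gram_diag_ge0 (X Y : finType) (K : mat R Y X) x : 0 <= (adj K ** K) x x.
Proof. by apply: sumr_ge0 => y _; rewrite mulrC mul_conjC_ge0. Qed.

Lemma gram_eq0 (X Y : finType) (K : mat R Y X) :
  (forall x, (adj K ** K) x x = 0) -> K = mzero.
Proof.
move=> K0; apply: mat_ext => y x; apply/eqP; rewrite -mul_conjC_eq0; apply/eqP.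
have /psumr_eq0P -> // : \sum_y K y x * Num.conj (K y x) = 0.
  by rewrite -[RHS](K0 x) /mmul /adj; apply: eq_bigr => z _; rewrite mulrC.
by move=> z _; exact: mul_conjC_ge0.
Qed.

Lemma diagmM (X : finType) (p q : X -> R) : diagm p ** diagm q = diagm (fun x => p x * q x).
Proof.
apply: mat_ext => x y; rewrite /mmul /diagm.
under eq_bigr do rewrite [(p x)%:C%C * _]mulrC -mulrA.
by rewrite sum_eq_mull mulrA rmorphM.
Qed.

Lemma adj_diagm (X : finType) (p : X -> R) : adj (diagm p) = diagm p.
Proof.
apply: mat_ext => x y; rewrite /adj /diagm rmorphM /= conj_realc rmorph_nat eq_sym.
by case: eqP => [->|]; rewrite ?mulr0.
Qed.

Lemma Re_mtr_diagm (X : finType) (p : X -> R) : Re (mtr (diagm p)) = \sum_x p x.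
Proof. by rewrite /mtr Re_sum; apply: eq_bigr => x _; rewrite /diagm eqxx mulr1. Qed.

Lemma msqrtP (X : finType) (A : mat R X X) :
  psd A -> psd (msqrt A) /\ msqrt A ** msqrt A = A.
Proof.
move=> A0; have [E [p [EE _ p0 AE]]] := psd_spectral A0.
have [|P0 PA] := @epsilon_spec _ (inhabits (fun _ _ => 0 : C))
    (fun P : mat R X X => psd P /\ (forall x y, (P ** P) x y = A x y)).
  (* Fourth roots of the eigenvalues make the square root a Gram matrix [adj K ** K], hence visibly
     positive. *)
  pose K := diagm (fun x => Num.sqrt (Num.sqrt (p x))) ** adj E.
  exists (adj K ** K); split=> [|x y]; first exact: psd_gram.
  have KK : adj K ** K = E ** diagm (fun x => Num.sqrt (p x)) ** adj E.
    rewrite adjM adjK adj_diagm mmulA -(mmulA E) diagmM; congr (_ ** diagm _ ** _).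
    by apply/funext => z; rewrite -expr2 sqr_sqrtr ?sqrtr_ge0.
  rewrite KK -!mmulA (mmulA (adj E)) EE mmul1m.
  rewrite (mmulA (diagm _)) diagmM AE -mmulA; congr ((_ ** (diagm _ ** _)) _ _).
  by apply/funext => z; rewrite -expr2 sqr_sqrtr.
by split=> //; apply: mat_ext.
Qed.

Lemma psd_Re_mtr_ge0 (X : finType) (P : mat R X X) : psd P -> 0 <= Re (mtr P).
Proof.
by move=> P0; apply: Re_ge0; have := psd_gram_trace (mone X) P0; rewrite adj_idm !mmul1m.
Qed.

Lemma trnorm_ge0 (X Y : finType) (A : mat R X Y) : 0 <= trnorm A.
Proof. by apply: psd_Re_mtr_ge0; case: (msqrtP (psd_gram A)). Qed.

Lemma fid_ge0 (X : finType) (rho sigma : mat R X X) : 0 <= fid rho sigma.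
Proof. exact: trnorm_ge0. Qed.

(** Expand the squared norm of [r u - v] in column [x], where [r] is the real part of the inner
    product: it equals [s ^ 2 - r ^ 2]. *)
Lemma Re_cauchy_schwarz (X Y : finType) (u v : mat R Y X) (x : X) (s : R) :
  (adj u ** u) x x = 1 -> (adj v ** v) x x = (s ^+ 2)%:C%C -> 0 <= s ->
  Re ((adj u ** v) x x) <= s.
Proof.
move=> u1 vs s0; set r := Re _.
have := Re_ge0 (gram_diag_ge0 (msub (mscale r%:C%C u) v) x).
have vu : (adj v ** u) x x = Num.conj ((adj u ** v) x x).
  by rewrite -[RHS]/(adj (adj u ** v) x x) adjM adjK.
rewrite adjB adjZ conj_realc !(mmulBl, mmulBr, mmulZl, mmulZr) /msub /mscale u1 vs vu.
rewrite !ReB !ReZ Re_conjc -/r /= => rs.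
rewrite leNgt; apply/negP => sr.
have : 0 < (r - s) * (r + s) by apply: mulr_gt0; lra.
lra.
Qed.

(** In an eigenbasis [e_x] of [|A|] the trace is the sum of the inner products of [W^* e_x] with
    [A e_x]. The first vector is a unit vector and the second has norm [p x], so Cauchy-Schwarz
    applies term by term. *)
Lemma trnorm_dual (X : finType) (W A : mat R X X) :
  W ** adj W = mone X -> Re (mtr (W ** A)) <= trnorm A.
Proof.
move=> WW; rewrite /trnorm; case: (msqrtP (psd_gram A)).
move: (msqrt (adj A ** A)) => P P0 PP; have [E [p [EE EE' p0 PE]]] := psd_spectral P0.
have -> : mtr P = mtr (diagm p) by rewrite PE -mmulA mtrC -mmulA EE mmulm1.
have -> : mtr (W ** A) = mtr (adj (adj W ** E) ** (A ** E)).
  by rewrite [LHS]mtrC adjM adjK [RHS]mtrC -!mmulA (mmulA E) EE' mmul1m.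
rewrite Re_mtr_diagm /mtr Re_sum; apply: ler_sum => x _; apply: Re_cauchy_schwarz => //.
  by rewrite adjM adjK -mmulA (mmulA W) WW mmul1m EE /idm eqxx.
rewrite adjM -mmulA (mmulA (adj A)) -PP PE -!mmulA EE mmulm1 (mmulA (adj E)) EE mmul1m.
rewrite (mmulA (adj E)) EE mmul1m diagmM /diagm eqxx mulr1.
by rewrite expr2.
Qed.

Lemma hermitian_sqr_diag (X : finType) (P : mat R X X) x :
  adj P = P -> 0 <= P x x -> Re (P x x) ^+ 2 <= Re ((P ** P) x x).
Proof.
move=> Pa Px; rewrite /mmul (bigD1 x) //= ReD -[leLHS]addr0 lerD //.
  by rewrite -[in leRHS](ge0_ReK Px) ReZ /= expr2.
rewrite Re_sum; apply: sumr_ge0 => y _.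
by rewrite -[P in P y x]Pa; apply/Re_ge0/mul_conjC_ge0.
Qed.

(** A crude bound that serves to show a set of trace norms bounded. It comes from [t <= 1 + t ^ 2]
    on the diagonal of [|A|]. *)
Lemma trnorm_le (X : finType) (A : mat R X X) :
  trnorm A <= #|X|%:R + \sum_x \sum_y Re (`|A x y| ^+ 2).
Proof.
rewrite /trnorm; case: (msqrtP (psd_gram A)).
move: (msqrt (adj A ** A)) => P P0 PP.
have -> : \sum_x \sum_y Re (`|A x y| ^+ 2) = Re (mtr (P ** P)).
  rewrite PP /mtr Re_sum exchange_big; apply: eq_bigr => x _; rewrite Re_sum.
  by apply: eq_bigr => y _; rewrite normCKC.
rewrite -sum1_card natr_sum /mtr !Re_sum -big_split; apply: ler_sum => x _ /=.
have Px : 0 <= P x x.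
  have := P0 (fun y => (y == x)%:R); congr (_ <= _).
  under eq_bigr => y _ do rewrite sum_eq_mulr conjC_nat mulrC.
  exact: sum_eq_mulr.
have := hermitian_sqr_diag (psd_adj P0) Px.
nra.
Qed.

Lemma proj_sandwich (X : finType) (A : mat R X X) (v : vec R X) :
  proj v ** A ** proj v = mscale (mtr (A ** proj v)) (proj v).
Proof.
apply: mat_ext => x y; rewrite -mmulA mtr_proj_mul /mscale /mmul /proj.
rewrite mulr_suml; apply: eq_bigr => a _; rewrite mulr_sumr mulr_suml.
by apply: eq_bigr => b _; ring.
Qed.

Lemma mtr_proj (X : finType) (v : vec R X) : unit_vec v -> mtr (proj v) = 1.
Proof. by move=> v1; rewrite -v1; apply: eq_bigr => x _; rewrite /proj mulrC. Qed.

Lemma proj_mapply (X Y : finType) (V : mat R X Y) (v : vec R Y) :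
  proj (mapply V v) = V ** proj v ** adj V.
Proof.
apply: mat_ext => x y; rewrite /proj /mapply /mmul rmorph_sum mulr_sumr.
apply: eq_bigr => m' _; rewrite !mulr_suml; apply: eq_bigr => m _.
by rewrite rmorphM /= /adj; ring.
Qed.

(** The Gram matrix of [K (1 - proj v)] is [(1 - proj v) K^2 (1 - proj v)], which vanishes. *)
Lemma psd_sqr_proj (X : finType) (K : mat R X X) (v : vec R X) c :
  unit_vec v -> psd K -> K ** K = mscale c (proj v) -> K ** proj v = K.
Proof.
move=> v1 K0 KK.
have K' : K ** msub (mone X) (proj v) = mzero.
  apply: gram_eq0 => x; rewrite adjM (psd_adj K0) -mmulA (mmulA K) KK.
  rewrite mmulZl mmulBr mmulm1 proj_idem // mmulZr /mscale adjB adj_idm adj_proj.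
  by rewrite mmulBl !mmulBr mmul1m proj_idem // /msub !subrr mulr0.
apply: mat_ext => x y; have := congr1 (fun A : mat R X X => A x y) K'.
by rewrite mmulBr mmulm1 /msub => /eqP; rewrite subr_eq0 => /eqP <-.
Qed.

(** The operator [K], the modulus of [r ** P], squares to a multiple of [proj v], so its expectation
    in [v] is its trace. Nonnegativity of its variance in [v] then bounds the squared trace by
    [c]. *)
Lemma fid_proj_le (X : finType) (rho : mat R X X) (v : vec R X) :
  psd rho -> unit_vec v -> fid rho (proj v) ^+ 2 <= Re (mtr (rho ** proj v)).
Proof.
move=> rho0 v1; rewrite /fid /trnorm.
case: (msqrtP rho0); move: (msqrt rho) => r r0 rr.
case: (msqrtP (psd_proj v)); move: (msqrt (proj v)) => P P0 PP.
case: (msqrtP (psd_gram (r ** P))); move: (msqrt (adj (r ** P) ** (r ** P))) => K K0 KK.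
have PQ : P ** proj v = P.
  by apply: (@psd_sqr_proj _ _ _ 1) => //; rewrite PP; apply: mat_ext => x y; rewrite /mscale mul1r.
have QP : proj v ** P = P by rewrite -[in RHS](psd_adj P0) -[in RHS]PQ adjM adj_proj (psd_adj P0).
set c := mtr (rho ** proj v).
have {}KK : K ** K = mscale c (proj v).
  have -> : K ** K = (P ** proj v) ** rho ** (proj v ** P).
    by rewrite KK adjM (psd_adj P0) (psd_adj r0) PQ QP -rr !mmulA.
  rewrite -!mmulA (mmulA rho) (mmulA (proj v)) (mmulA (proj v) rho) proj_sandwich.
  by rewrite mmulZl QP mmulZr PP.
have KQ := psd_sqr_proj v1 K0 KK.
have := psd_gram_trace (msub (mscale (Re (mtr K))%:C%C (mone X)) K) (psd_proj v).
rewrite adjB adjZ conj_realc adj_idm (psd_adj K0) !(mmulBl, mmulBr, mmulZl, mmulZr, mmul1m, mmulm1).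
rewrite KK mmulZl proj_idem // KQ !(mtrB, mtrZ) mtr_proj //.
move=> /Re_ge0; rewrite !(ReB, ReZ) mulr1 /= mulr1; lra.
Qed.

(** With [B = 1 - Q] and [Q T Q = 0] one has [T = B T + Q T B]. By Cauchy-Schwarz each summand has
    expectation at most the square root of that of [B], whence the factor 2. *)
Lemma decoupling (X : finType) (tau T Q : mat R X X) :
  psd tau -> mtr tau = 1 -> adj T = T -> T ** T = mone X -> adj Q = Q -> Q ** Q = Q ->
  Q ** T ** Q = mzero ->
  Re (mtr (T ** tau)) <= 2 * Num.sqrt (1 - Re (mtr (Q ** tau))).
Proof.
move=> tau0 tau1 Ta TT Qa QQ QTQ.
have conj_ex A : Re (mtr (adj A ** tau)) = Re (mtr (A ** tau)).
  by rewrite -{1}(psd_adj tau0) -adjM mtr_adj Re_conjc mtrC.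
set t := Re (mtr (T ** tau)); set q := Re (mtr (Q ** tau)); set x := Re (mtr (Q ** T ** tau)).
have TQ : Re (mtr (T ** Q ** tau)) = x by rewrite -conj_ex adjM Ta Qa.
have zero0 : Re (mtr ((mzero : mat R X X) ** tau)) = 0.
  by rewrite /mtr /mmul big1 // => a _; rewrite big1 // => b _; rewrite mul0r.
pose B := msub (mone X) Q.
have Ba : adj B = B by rewrite adjB adj_idm Qa.
have BB : B ** B = B.
  rewrite /B mmulBl !mmulBr !mmul1m mmulm1 QQ.
  by apply: mat_ext => a b; rewrite /msub subrr subr0.
have exB : Re (mtr (B ** tau)) = 1 - q by rewrite mmulBl mmul1m mtrB ReB tau1.
have exBT : Re (mtr (B ** T ** tau)) = t - x by rewrite !mmulBl mmul1m mtrB ReB.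
have exTB : Re (mtr (T ** B ** tau)) = t - x by rewrite -conj_ex adjM Ta Ba.
have exBTQ : Re (mtr (B ** (T ** Q) ** tau)) = x.
  by rewrite !mmulBl mmul1m (mmulA Q) QTQ mtrB ReB zero0 TQ subr0.
have exQTB : Re (mtr (Q ** T ** B ** tau)) = x by rewrite -conj_ex !adjM Ta Ba Qa.
clearbody B.
have q1 : 0 <= 1 - q by have := Re_ge0 (psd_gram_trace B tau0); rewrite Ba BB exB.
have q0 : 0 <= q by have := Re_ge0 (psd_gram_trace Q tau0); rewrite Qa QQ.
(* Both uses of Cauchy-Schwarz are kept as quadratic inequalities with a common free scale [c], from
   the second moments of [c B - T] and [c B - T Q]. *)
have main (c : R) : 2 * c * t <= 2 * c ^+ 2 * (1 - q) + 2.
  have h1 := Re_ge0 (psd_gram_trace (msub (mscale c%:C%C B) T) tau0).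
  have h2 := Re_ge0 (psd_gram_trace (msub (mscale c%:C%C B) (T ** Q)) tau0).
  have {}h1 : 0 <= c * (c * (1 - q) - (t - x)) - (c * (t - x) - 1).
    move: h1; rewrite adjB adjZ conj_realc Ta Ba !(mmulBl, mmulBr, mmulZl, mmulZr) BB TT.
    rewrite mmul1m !(mtrB, mtrZ) tau1 !(ReB, ReZ) exB exBT exTB /=; lra.
  have {}h2 : 0 <= c * (c * (1 - q) - x) - (c * x - q).
    move: h2; rewrite adjB adjZ conj_realc adjM Ta Ba Qa !(mmulBl, mmulBr, mmulZl, mmulZr) BB.
    have -> : Q ** T ** (T ** Q) = Q by rewrite -mmulA (mmulA T) TT mmul1m QQ.
    rewrite !(mtrB, mtrZ) !(ReB, ReZ) exB exBTQ exQTB -/q; lra.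
  lra.
set s := Num.sqrt _; have s0 : 0 <= s by exact: sqrtr_ge0.
have s2 : 1 - q = s ^+ 2 by rewrite sqr_sqrtr.
rewrite s2 in main.
(* The optimal scale is [c = s^-1]. For [s = 0] the bound is linear in [c], and [c = 2 / t] refutes
   [0 < t]. *)
have [s_gt0|] := ltP 0 s; last first.
  move=> s_le0; have s00 : s = 0 by lra.
  rewrite s00 in main *; rewrite leNgt; apply/negP => t0.
  have t_gt0 : 0 < t by lra.
  have := main (2 / t); rewrite expr0n mulr0 add0r -mulrA divfK ?gt_eqF //; lra.
have := main s^-1.
have -> : 2 * s^-1 ^+ 2 * s ^+ 2 + 2 = 4 by field; rewrite lt0r_neq0.
rewrite mulrAC => h; have : 2 * t <= 4 * s by rewrite -ler_pdivrMr.
lra.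
Qed.

End TraceNorm.

(** * Operators supported on a set of qubits *)

Section Support.
Variable R : realType.
Local Notation C := (R[i]).
Local Notation mone X := (@idm R X).
Variable n : nat.
Implicit Types (S T : {set 'I_n}) (x y u : qb n).

(** Agreement off [S], in the same form as the condition inside [ptr], so that it can be folded
    there. *)
Definition agree S x y := [forall i, (i \notin S) ==> (x i == y i)].

Lemma agreeP S x y : reflect (forall i, i \notin S -> x i = y i) (agree S x y).
Proof.
apply: (iffP forallP) => h i; first by move/(implyP (h i))/eqP.
by apply/implyP => /h ->.
Qed.

Lemma agreexx S x : agree S x x. Proof. exact/agreeP. Qed.

Lemma agree_sym S x y : agree S x y = agree S y x.
Proof. by apply/agreeP/agreeP => h i /h ->. Qed.

Lemma agree_trans S x y u : agree S x y -> agree S x u = agree S y u.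
Proof. by move=> /agreeP xy; apply/agreeP/agreeP => h i iS; rewrite -h // xy. Qed.

Definition glue S (a : subq S) x : qb n :=
  [ffun i => if insub i is Some j then a j else x i].

Lemma glue_in S (a : subq S) x i (iS : i \in S) : glue a x i = a (exist _ i iS).
Proof. by rewrite ffunE insubT. Qed.

Lemma glue_notin S (a : subq S) x i : i \notin S -> glue a x i = x i.
Proof. by move=> iS; rewrite ffunE insubN. Qed.

Lemma restrE S x y : (restr S x = restr S y) <-> (forall i, i \in S -> x i = y i).
Proof.
split=> [xy i iS|xy]; last by apply/ffunP => -[i iS]; rewrite !ffunE xy.
by have /ffunP/(_ (exist _ i iS)) := xy; rewrite !ffunE.
Qed.

Lemma restr_glue S (a : subq S) x : restr S (glue a x) = a.
Proof. by apply/ffunP => -[i iS]; rewrite ffunE glue_in. Qed.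

Lemma glue_agree S (a : subq S) x : agree S (glue a x) x.
Proof. by apply/agreeP => i; exact: glue_notin. Qed.

Lemma glue_restr S x u : agree S u x -> glue (restr S u) x = u.
Proof.
move=> /agreeP ux; apply/ffunP => i; case: (boolP (i \in S)) => iS.
  by rewrite glue_in ffunE.
by rewrite glue_notin // ux.
Qed.

Lemma sum_glue S x (F : qb n -> C) :
  \sum_(u | agree S u x) F u = \sum_(a : subq S) F (glue a x).
Proof.
rewrite (reindex (fun a : subq S => glue a x)) /=.
  by apply: eq_bigl => a; rewrite glue_agree.
by exists (restr S) => [a _|u]; [exact: restr_glue|rewrite inE => /glue_restr].
Qed.

Lemma sum_boolmul (X : finType) (P : pred X) (F : X -> C) :
  \sum_x (P x)%:R * F x = \sum_(x | P x) F x.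
Proof. by rewrite [RHS]big_mkcond; apply: eq_bigr => x _; case: (P x); rewrite ?mul1r ?mul0r. Qed.

(** The operator [a] on the block [S], tensored with the identity on the other qubits. *)
Definition embed S (a : mat R (subq S) (subq S)) : mat R (qb n) (qb n) :=
  fun x y => (agree S x y)%:R * a (restr S x) (restr S y).

Lemma embed_mul S (a b : mat R (subq S) (subq S)) : embed (a ** b) = embed a ** embed b.
Proof.
apply: mat_ext => x y; rewrite {2}/mmul /embed.
under eq_bigr do rewrite -mulrA agree_sym.
rewrite sum_boolmul sum_glue mulr_sumr; apply: eq_bigr => c _.
by rewrite restr_glue (agree_trans y (glue_agree c x)) mulrCA.
Qed.

Lemma embed_idm S : embed (mone (subq S)) = mone (qb n).
Proof.
apply: mat_ext => x y; rewrite /embed /idm.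
have -> : (x == y) = agree S x y && (restr S x == restr S y).
  apply/eqP/andP => [->|[/agreeP xy /eqP/restrE xy']]; first by rewrite agreexx.
  by apply/ffunP => i; case: (boolP (i \in S)) => [/xy'|/xy].
by rewrite -natrM mulnb.
Qed.

Lemma embed_adj S (a : mat R (subq S) (subq S)) : embed (adj a) = adj (embed a).
Proof.
by apply: mat_ext => x y; rewrite /embed /adj rmorphM /= rmorph_nat agree_sym.
Qed.

Lemma embed_inj S (a b : mat R (subq S) (subq S)) : embed a = embed b -> a = b.
Proof.
move=> ab; apply: mat_ext => r r'; pose z : qb n := [ffun=> false].
have := congr1 (fun A : mat R (qb n) (qb n) => A (glue r z) (glue r' z)) ab.
rewrite /embed !restr_glue (agree_trans _ (glue_agree r z)) agree_sym glue_agree.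
by rewrite !mul1r.
Qed.

(** The partial trace is dual to [embed]: both sides reduce to one sum over pairs of
    configurations. *)
Lemma mtr_embed_mul S (a : mat R (subq S) (subq S)) (rho : mat R (qb n) (qb n)) :
  mtr (embed a ** rho) = mtr (a ** ptr (S := S) rho).
Proof.
rewrite /mtr /mmul /ptr.
under [RHS]eq_bigr => r _.
  under eq_bigr => r' _.
    rewrite mulr_sumr; under eq_bigr => x _ do rewrite mulr_sumr.
    over.
  rewrite exchange_big /=; under eq_bigr => x _.
    rewrite exchange_big /=; over.
  over.
rewrite [RHS]exchange_big /= [LHS]exchange_big /=; apply: eq_bigr => x _.
rewrite [RHS]exchange_big /=; apply: eq_bigr => y _.
rewrite (bigD1 (restr S y)) //= (bigD1 (restr S x)) //= !eqxx /=.
rewrite /embed -/(agree S x y) agree_sym big1 ?addr0 => [|r' /negPf r'x]; last first.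
  by rewrite eq_sym r'x mul0r mulr0.
rewrite big1 ?addr0 => [|r /negPf ry]; first by ring.
by apply: big1 => r' _; rewrite [_ == r]eq_sym ry andbF mul0r mulr0.
Qed.

(* [A] acts as the identity outside [S]. *)
Definition supported S (A : mat R (qb n) (qb n)) :=
  (forall x y, ~~ agree S x y -> A x y = 0) /\
  (forall x y x' y', agree S x y -> agree S x' y' ->
     restr S x = restr S x' -> restr S y = restr S y' -> A x y = A x' y').

Lemma supported_embed S a : supported S (embed (S := S) a).
Proof.
split=> [x y /negPf xy|x y x' y' xy xy' xx yy]; rewrite /embed.
  by rewrite xy mul0r.
by rewrite xy xy' xx yy.
Qed.

Lemma supported_embedP S A : supported S A -> exists a, A = embed (S := S) a.
Proof.
move=> [A0 A1]; pose z : qb n := [ffun=> false].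
exists (fun r r' => A (glue r z) (glue r' z)); apply: mat_ext => x y; rewrite /embed.
case: (boolP (agree S x y)) => [xy|/A0 ->]; last by rewrite mul0r.
rewrite mul1r; apply: A1 => //; rewrite ?restr_glue //.
by rewrite (agree_trans _ (glue_agree _ z)) agree_sym glue_agree.
Qed.

Lemma supported_mul S A B : supported S A -> supported S B -> supported S (A ** B).
Proof.
move=> /supported_embedP[a ->] /supported_embedP[b ->]; rewrite -embed_mul.
exact: supported_embed.
Qed.

Lemma supported_adj S A : supported S A -> supported S (adj A).
Proof. by move=> /supported_embedP[a ->]; rewrite -embed_adj; exact: supported_embed. Qed.

Lemma supported_sub S T A : S \subset T -> supported S A -> supported T A.
Proof.
move=> /fintype.subsetP ST [A0 A1]; split=> [x y|x y x' y' /agreeP xyT /agreeP xyT' /restrE xx /restrE yy].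
  move=> xy; apply: A0; apply: contra xy => /agreeP xy; apply/agreeP => i iT.
  by apply: xy; apply: contra iT => /ST.
(* The two pairs coincide inside [T], and each agrees outside [T]; so both agree off [S] or neither
   does. *)
have SE : agree S x y = agree S x' y'.
  apply/agreeP/agreeP => h i iS; case: (boolP (i \in T)) => iT.
  - by rewrite -xx // -yy // h.
  - exact: xyT'.
  - by rewrite xx // yy // h.
  - exact: xyT.
case: (boolP (agree S x y)) => xy; last by rewrite !A0 // -SE.
by apply: A1; rewrite -?SE //; apply/restrE => i /ST iT; [exact: xx|exact: yy].
Qed.

(** [A] leaves the bits off [S] alone and [B] those off [T], so the only intermediate configuration
    takes its bits on [S] from [y] and the others from [x]. *)
Lemma supported_mulE S T A B x y : supported S A -> supported T B -> [disjoint S & T] ->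
  (A ** B) x y = A x (glue (restr S y) x) * B (glue (restr S y) x) y.
Proof.
move=> [A0 _] [B0 _] ST; rewrite /mmul (bigD1 (glue (restr S y) x)) //= big1 ?addr0 // => u uN.
case: (boolP (agree S x u)) => [xu|/A0 ->]; last by rewrite mul0r.
case: (boolP (agree T u y)) => [uy|/B0 ->]; last by rewrite mulr0.
case/negP: uN; apply/eqP/ffunP => i; case: (boolP (i \in S)) => iS.
  by rewrite glue_in ffunE; apply: (agreeP _ _ _ uy); rewrite (disjointFr ST).
by rewrite glue_notin //; apply/esym/(agreeP _ _ _ xu).
Qed.

(** The two orders pass through different intermediate configurations [u] and [w], but the entries
    of [A] and of [B] met on the way have the same restrictions to [S] and to [T]. *)
Lemma supported_comm S T A B :
  supported S A -> supported T B -> [disjoint S & T] -> A ** B = B ** A.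
Proof.
move=> sA sB ST; have TS : [disjoint T & S] by rewrite disjoint_sym.
apply: mat_ext => x y; rewrite (supported_mulE _ _ sA sB ST) (supported_mulE _ _ sB sA TS).
rewrite mulrC; move: sA sB => [A0 A1] [B0 B1].
set u := glue (restr S y) x; set w := glue (restr T y) x.
have uS i : i \in S -> u i = y i by move=> iS; rewrite /u glue_in ffunE.
have uN i : i \notin S -> u i = x i by exact: glue_notin.
have wT i : i \in T -> w i = y i by move=> iT; rewrite /w glue_in ffunE.
have wN i : i \notin T -> w i = x i by exact: glue_notin.
have ST' i : i \in S -> i \notin T by move=> iS; rewrite (disjointFr ST).
have TS' i : i \in T -> i \notin S by move=> iT; rewrite (disjointFr TS).
have xu : agree S x u by apply/agreeP => i /uN.
have xw : agree T x w by apply/agreeP => i /wN.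
case: (boolP (agree T u y)) => [uy|uy]; last first.
  rewrite (B0 _ _ uy) mul0r (A0 w y) ?mulr0 //.
  apply: contra uy => /agreeP wy; apply/agreeP => i iT.
  case: (boolP (i \in S)) => iS; first exact: uS.
  by rewrite uN // -wN // wy.
have wy : agree S w y.
  apply/agreeP => i iS; case: (boolP (i \in T)) => iT; first exact: wT.
  by rewrite wN // -uN //; apply: (agreeP _ _ _ uy).
congr (_ * _).
  by apply: B1 => //; apply/restrE => i iT; [rewrite uN // TS'|rewrite wT].
by apply: A1 => //; apply/restrE => i iS; [rewrite wN // ST'|rewrite uS].
Qed.

End Support.

(** * Light cones of circuits *)

Section LightCone.
Variable R : realType.
Local Notation C := (R[i]).
Local Notation mone X := (@idm R X).
Local Notation bit2 := (bool * bool)%type.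
Variable n : nat.
Implicit Types (p : ('I_n * 'I_n)%type) (P : {set ('I_n * 'I_n)%type}) (x y u : qb n).

Definition unitary (X : finType) (U : mat R X X) := U ** adj U = mone X /\ adj U ** U = mone X.

Lemma unitary_mul (X : finType) (U U' : mat R X X) :
  unitary U -> unitary U' -> unitary (U ** U').
Proof.
move=> [U1 U2] [U3 U4]; rewrite /unitary adjM; split.
  by rewrite -!mmulA (mmulA U') U3 mmul1m.
by rewrite -!mmulA (mmulA (adj U)) U2 mmul1m.
Qed.

Lemma unitary_idm (X : finType) : unitary (mone X).
Proof. by rewrite /unitary adj_idm mmul1m. Qed.

Lemma qunitaryE (X : finType) (U : mat R X X) : qunitary U -> unitary U.
Proof. by move=> [U1 U2]; split; apply: mat_ext. Qed.

(** * Two-qubit gates and layers *)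

Definition psupp p : {set 'I_n} := [set p.1; p.2].

(** Unlike [embed], this keeps the order of the pair, on which the index type [bool * bool] of a
    gate depends. *)
Definition gate p (G : mat R bit2 bit2) : mat R (qb n) (qb n) :=
  fun x y => (agree (psupp p) x y)%:R * G (x p.1, x p.2) (y p.1, y p.2).

Definition upd p (b : bit2) x : qb n :=
  [ffun i => if i == p.1 then b.1 else if i == p.2 then b.2 else x i].

Lemma upd1 p b x : upd p b x p.1 = b.1. Proof. by rewrite ffunE eqxx. Qed.

Lemma upd2 p b x : p.1 != p.2 -> upd p b x p.2 = b.2.
Proof. by move=> /negPf pp; rewrite ffunE eq_sym pp eqxx. Qed.

Lemma upd_agree p b x : agree (psupp p) (upd p b x) x.
Proof.
by apply/agreeP => i; rewrite !inE negb_or ffunE => /andP[/negPf -> /negPf ->].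
Qed.

Lemma upd_self p x u : agree (psupp p) u x -> upd p (u p.1, u p.2) x = u.
Proof.
move=> /agreeP ux; apply/ffunP => i; rewrite ffunE.
case: eqP => [->//|/eqP i1]; case: eqP => [->//|/eqP i2].
by rewrite ux // !inE negb_or i1 i2.
Qed.

Lemma sum_upd p x (F : qb n -> C) : p.1 != p.2 ->
  \sum_(u | agree (psupp p) u x) F u = \sum_b F (upd p b x).
Proof.
move=> pp; rewrite (reindex (fun b => upd p b x)) /=.
  by apply: eq_bigl => a; rewrite upd_agree.
exists (fun u => (u p.1, u p.2)) => [[b1 b2] _|u].
  by rewrite upd1 upd2.
by rewrite inE => /upd_self.
Qed.

Lemma gate_mul p (G H : mat R bit2 bit2) : p.1 != p.2 -> gate p (G ** H) = gate p G ** gate p H.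
Proof.
move=> pp; apply: mat_ext => x y; rewrite {2}/mmul /gate.
under eq_bigr do rewrite -mulrA agree_sym.
rewrite sum_boolmul sum_upd // mulr_sumr; apply: eq_bigr => -[b1 b2] _.
by rewrite upd1 upd2 // (agree_trans y (upd_agree p (b1, b2) x)) mulrCA.
Qed.

Lemma gate_idm p : gate p (mone bit2) = mone (qb n).
Proof.
apply: mat_ext => x y; rewrite /gate /idm -natrM mulnb; congr (nat_of_bool _)%:R.
apply/andP/eqP => [[/upd_self xy /eqP xy']|->]; last by rewrite agreexx.
by rewrite -xy xy' upd_self // agreexx.
Qed.

Lemma gate_adj p G : gate p (adj G) = adj (gate p G).
Proof. by apply: mat_ext => x y; rewrite /gate /adj rmorphM /= rmorph_nat agree_sym. Qed.

Lemma gate_unitary p G : p.1 != p.2 -> unitary G -> unitary (gate p G).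
Proof. by move=> pp [G1 G2]; rewrite /unitary -gate_adj -!gate_mul // G1 G2 gate_idm. Qed.

Lemma supported_gate p G : supported (psupp p) (gate p G).
Proof.
split=> [x y /negPf xy|x y x' y' xy xy' /restrE xx /restrE yy]; rewrite /gate.
  by rewrite xy mul0r.
by rewrite xy xy' !xx ?yy // !inE eqxx ?orbT.
Qed.

Lemma layer_op0 U : @layer_op R n finset.set0 U = mone (qb n).
Proof.
apply: mat_ext => x y; rewrite /layer_op big_set0 mul1r /idm; congr (nat_of_bool _)%:R.
apply/forallP/eqP => [h|-> q]; last by rewrite eqxx implybT.
apply/ffunP => q; apply/eqP; apply: (implyP (h q)).
by apply/negP => /existsP[p]; rewrite inE.
Qed.

(** Peels one gate off a layer, for induction on the set of pairs. In the product only the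
    configuration with the bits of [y] on [p] and those of [x] elsewhere survives. *)
Lemma layer_opU1 P p (U : ('I_n * 'I_n)%type -> mat R bit2 bit2) :
  p \notin P -> p.1 != p.2 ->
  (forall p', p' \in P -> [&& p.1 != p'.1, p.1 != p'.2, p.2 != p'.1 & p.2 != p'.2]) ->
  layer_op (p |: P)%SET U = gate p (U p) ** layer_op P U.
Proof.
move=> pP pp dis; apply: mat_ext => x y.
have covN q : covered P q -> q \notin psupp p.
  move=> /existsP[p' /andP[/dis /and4P[n1 n2 n3 n4] /orP[]/eqP <-]];
    by rewrite !inE negb_or ![_ == p.1]eq_sym ![_ == p.2]eq_sym ?n1 ?n2 ?n3 ?n4.
have covU q : covered (p |: P)%SET q = (q \in psupp p) || covered P q.
  apply/existsP/orP => [[p' /andP[]]|].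
    rewrite !inE => /orP[/eqP ->|p'P] e.
      by left; rewrite ![q == _]eq_sym.
    by right; apply/existsP; exists p'; rewrite p'P.
  case=> [|/existsP[p' /andP[p'P e]]].
    by rewrite !inE => e; exists p; rewrite !inE eqxx ![_ == q]eq_sym.
  by exists p'; rewrite !inE p'P orbT.
pose u := upd p (y p.1, y p.2) x.
have ux : agree (psupp p) u x by exact: upd_agree.
rewrite /mmul (bigD1 u) //= big1 ?addr0 => [|w wu]; last first.
  rewrite /gate /layer_op; case: (boolP (agree _ x w)) => [xw|_]; last by rewrite !mul0r.
  case: forallP => [h|_]; last by rewrite !mulr0.
  case/eqP: wu; rewrite agree_sym in xw; rewrite -(upd_self xw) /u; congr (upd p (_, _) x).
    apply/eqP/(implyP (h _)); apply/negP => /covN; by rewrite !inE eqxx.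
  apply/eqP/(implyP (h _)); apply/negP => /covN; by rewrite !inE eqxx orbT.
rewrite /gate agree_sym ux mul1r /layer_op big_setU1 //= upd1 upd2 // -mulrA; congr (_ * (_ * _)).
  apply: eq_bigr => p' /dis/and4P[n1 n2 n3 n4].
  have uq q : q \notin psupp p -> u q = x q by move/agreeP: ux; apply.
  by rewrite !uq // !inE negb_or ![_ == p.1]eq_sym ![_ == p.2]eq_sym ?n1 ?n2 ?n3 ?n4.
congr (nat_of_bool _)%:R; apply/forallP/forallP => h q; apply/implyP => qP.
  case: (boolP (q \in psupp p)) => qp.
    by move: qp; rewrite !inE => /orP[]/eqP ->; rewrite /u ?upd1 ?upd2.
  rewrite (agreeP _ _ _ ux) //; apply: (implyP (h q)); by rewrite covU negb_or qp.
move: qP; rewrite covU negb_or => /andP[qp qP].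
by rewrite -(agreeP _ _ _ ux) //; apply: (implyP (h q)).
Qed.

(** * Growth of supports under a layer and under a circuit *)

Definition closed_under P (S : {set 'I_n}) := forall p, p \in P -> (p.1 \in S) = (p.2 \in S).

(** Since no pair straddles the boundary of [S], each gate either lies inside [S] and preserves the
    support, or is disjoint from [S], commutes with the operator and cancels against its adjoint. *)
Lemma layer_conj P (U : ('I_n * 'I_n)%type -> mat R bit2 bit2) :
  valid_pairs P -> (forall p, p \in P -> qunitary (U p)) ->
  unitary (layer_op P U) /\
  forall S A, closed_under P S -> supported S A ->
    supported S (layer_op P U ** A ** adj (layer_op P U)).
Proof.
move: {2}#|P| (leqnn #|P|) => m; elim: m P => [|m IH] P.
  rewrite leqn0 cards_eq0 => /eqP -> _ _; rewrite layer_op0 adj_idm.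
  by split=> [|S A _]; [exact: unitary_idm|rewrite mmul1m mmulm1].
move=> Pm [valid1 valid2] uni.
have [->|[p pP]] := set_0Vmem P.
  rewrite layer_op0 adj_idm.
  by split=> [|S A _]; [exact: unitary_idm|rewrite mmul1m mmulm1].
pose P' := (P :\ p)%SET; have PE : P = (p |: P')%SET by rewrite finset.setD1K.
have P'P q : q \in P' -> q \in P /\ p != q by rewrite !inE eq_sym => /andP[-> ->].
have pp := valid1 p pP.
have -> : layer_op P U = gate p (U p) ** layer_op P' U.
  rewrite {1}PE layer_opU1 ?inE ?eqxx // => q /P'P[qP pq]; exact: valid2.
have [|||uni' supp'] := IH P'.
- by rewrite -ltnS (leq_trans _ Pm) // [in leqRHS]PE cardsU1 !inE eqxx.
- by split=> [q /P'P[/valid1]|q q' /P'P[qP _] /P'P[qP' _]]; [|exact: valid2].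
- by move=> q /P'P[/uni].
have [g1 g2] := gate_unitary pp (qunitaryE (uni p pP)).
split=> [|S A cl sA]; first exact: unitary_mul.
set g := gate p (U p) in g1 g2 *; set L := layer_op P' U in uni' supp' *.
have sB : supported S (L ** A ** adj L) by apply: supp' => // q /P'P[/cl].
have -> : g ** L ** A ** adj (g ** L) = g ** (L ** A ** adj L) ** adj g.
  by rewrite adjM !mmulA.
case: (boolP (p.1 \in S)) => pS.
  have sg : supported S g.
    apply: supported_sub (supported_gate p (U p)).
    by apply/fintype.subsetP => i; rewrite !inE => /orP[]/eqP -> //; rewrite -cl.
  by apply: supported_mul (supported_adj sg); apply: supported_mul sg sB.
rewrite (supported_comm (supported_gate p (U p)) sB); first by rewrite -/g -(mmulA _ g) g1 mmulm1.
rewrite disjoint_subset; apply/fintype.subsetP => i; rewrite !inE => /orP[]/eqP -> //.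
by rewrite -cl.
Qed.

(** Serves to count the light cone: adding the partners to a set at most doubles it. A qubit touched
    by no gate is its own partner. *)
Definition partner P (q : 'I_n) : 'I_n :=
  if [pick p in P | (p.1 == q) || (p.2 == q)] is Some p
  then (if p.1 == q then p.2 else p.1) else q.

Lemma partnerE P p : valid_pairs P -> p \in P -> partner P p.1 = p.2 /\ partner P p.2 = p.1.
Proof.
move=> [valid1 valid2] pP.
have uniq q p' : (p.1 == q) || (p.2 == q) -> p' \in P -> (p'.1 == q) || (p'.2 == q) -> p' = p.
  move=> pq p'P p'q; apply/eqP/negPn/negP => /(valid2 _ _ p'P pP)/and4P[n1 n2 n3 n4].
  move: pq p'q n1 n2 n3 n4.
  by case/orP=> /eqP <- /orP[]/eqP <-; rewrite eqxx.
rewrite /partner; split; case: pickP => [p' /andP[p'P e]|/(_ p)].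
- by rewrite (uniq _ _ _ p'P e) eqxx.
- by rewrite pP eqxx.
- by rewrite (uniq _ _ _ p'P e) ?eqxx ?orbT // (negPf (valid1 _ pP)).
- by rewrite pP eqxx orbT.
Qed.

(** Add to [S] every pair meeting it. As pairs are disjoint, a pair meeting the enlarged set already
    meets [S], so one step suffices. *)
Lemma closed_cone P (S : {set 'I_n}) : valid_pairs P ->
  exists S' : {set 'I_n}, [/\ S \subset S', closed_under P S' & (#|S'| <= 2 * #|S|)%N].
Proof.
move=> valid; exists (S :|: \bigcup_(p in P | (p.1 \in S) || (p.2 \in S)) psupp p)%SET.
split.
- exact: finset.subsetUl.
- move=> p pP; have [valid1 valid2] := valid.
  have both q : q \in psupp p ->
      q \in (S :|: \bigcup_(p in P | (p.1 \in S) || (p.2 \in S)) psupp p)%SET ->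
      psupp p \subset (S :|: \bigcup_(p in P | (p.1 \in S) || (p.2 \in S)) psupp p)%SET.
    move=> qp qS; apply: fintype.subset_trans (finset.subsetUr _ _).
    apply: finset.bigcup_sup; rewrite pP /=.
    move: qS; rewrite finset.inE => /orP[qS|/finset.bigcupP[p' /andP[p'P p'S] qp']].
      by move: qp; rewrite !inE => /orP[]/eqP <-; rewrite qS ?orbT.
    have [->//|/(valid2 _ _ pP p'P)/and4P[n1 n2 n3 n4]] := eqVneq p p'.
    move: qp qp'; rewrite !inE => /orP[]/eqP ->.
      by rewrite (negPf n1) (negPf n2).
    by rewrite (negPf n3) (negPf n4).
  apply/idP/idP => h.
    by apply: (fintype.subsetP (both p.1 _ h)); rewrite !inE eqxx ?orbT.
  by apply: (fintype.subsetP (both p.2 _ h)); rewrite !inE eqxx ?orbT.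
apply: (@leq_trans #|(S :|: partner P @: S)%SET|).
  apply/subset_leq_card/fintype.subsetP => i; rewrite finset.inE => /orP[iS|].
    by rewrite finset.inE iS.
  case/finset.bigcupP => p /andP[pP pS]; have [e1 e2] := partnerE valid pP.
  rewrite !finset.inE => /orP[]/eqP ->; case/orP: pS => pS; rewrite ?pS //; apply/orP; right.
    by rewrite -e2 imset_f.
  by rewrite -e1 imset_f.
rewrite mul2n -addnn (leq_trans (leq_card_setU _ _)) // leq_add2l.
exact: leq_imset_card.
Qed.

Lemma layer_light_cone (L : mat R (qb n) (qb n)) : is_layer L ->
  unitary L /\ forall S A, supported S A ->
    exists S' : {set 'I_n}, (#|S'| <= 2 * #|S|)%N /\ supported S' (L ** A ** adj L).
Proof.
move=> [P [U [valid [uni LE]]]].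
have -> : L = layer_op P U by apply: mat_ext.
have [uniL suppL] := layer_conj valid uni; split=> // S A sA.
have [S' [SS' cl S'S]] := closed_cone S valid.
by exists S'; split=> //; apply: suppL cl _; apply: supported_sub sA.
Qed.

(** The head of the list acts last, as in [run], so conjugation starts with the tail. *)
Definition circuit_op (c : seq (mat R (qb n) (qb n))) := foldr (@mmul R _ _ _) (mone (qb n)) c.

Lemma run_circuit_op c : run c = mapply (circuit_op c) (@zero_state R n).
Proof.
elim: c => [|L c IH] /=; apply/funext => x; rewrite /mapply.
  by rewrite /idm sum_eq_mull.
rewrite -/(run c) IH /mapply /mmul.
under eq_bigr do rewrite mulr_sumr.
rewrite exchange_big; apply: eq_bigr => y _; rewrite mulr_suml.
by apply: eq_bigr => z _; rewrite mulrA.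
Qed.

Lemma circuit_light_cone c : (forall L, L \in c -> is_layer L) ->
  unitary (circuit_op c) /\ forall S A, supported S A ->
    exists S' : {set 'I_n}, (#|S'| <= 2 ^ size c * #|S|)%N /\
      supported S' (circuit_op c ** A ** adj (circuit_op c)).
Proof.
elim: c => [|L c IH] layers /=.
  split=> [|S A sA]; first exact: unitary_idm.
  by exists S; rewrite expn0 mul1n adj_idm mmul1m mmulm1.
have [|uc sc] := IH; first by move=> L' L'c; apply: layers; rewrite inE L'c orbT.
have [uL sL] := layer_light_cone (layers L (mem_head _ _)).
split=> [|S A sA]; first exact: unitary_mul.
have [S' [S'S sS']] := sc _ _ sA; have [S'' [S''S sS'']] := sL _ _ sS'.
exists S''; split; last by move: sS''; rewrite adjM !mmulA.
by rewrite expnS -mulnA (leq_trans S''S) // leq_mul2l S'S orbT.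
Qed.

End LightCone.

(** * Entropy of distributions with small marginals *)

Section Entropy.
Variable R : realType.

(** This is [ln (1 + u) <= u] at [u = r / p - 1], multiplied by [p]. *)
Lemma gibbs_le (p r : R) : 0 <= p -> 0 < r -> p * ln r - p * ln p <= r - p.
Proof.
rewrite le_eqVlt => /orP[/eqP <- r0|p0 r0]; first by rewrite !mul0r !subr0 ltW.
have : ln (1 + (r / p - 1)) <= r / p - 1.
  by apply: le_ln1Dx; rewrite ltrBrDr addNr divr_gt0.
rewrite addrC subrK ln_div ?posrE // => h.
have -> : r - p = p * (r / p - 1) by field; rewrite gt_eqF.
by rewrite -mulrBr ler_wpM2l // ltW.
Qed.

Lemma ln_prod (I : Type) (s : seq I) (F : I -> R) : (forall i, 0 < F i) ->
  ln (\prod_(i <- s) F i) = \sum_(i <- s) ln (F i).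
Proof.
move=> F0; elim: s => [|i s IH]; first by rewrite !big_nil ln1.
by rewrite !big_cons lnM ?posrE ?IH // prodr_gt0.
Qed.

Lemma ln2_gt0 : 0 < ln 2 :> R.
Proof. by rewrite ln_gt0 // ltr1n. Qed.

Lemma H2_ge0 (q : R) : 0 <= q -> q < 1 / 2 -> 0 <= H2 q.
Proof.
move=> q0 q1; rewrite /H2 mulNr -opprD oppr_ge0 /log2 !mulrA -mulrDl.
rewrite pmulr_lle0 ?invr_gt0 ?ln2_gt0 // -oppr_ge0 opprD addr_ge0 //.
  by rewrite oppr_ge0 mulr_ge0_le0 // ln_le0 //; lra.
by rewrite oppr_ge0 mulr_ge0_le0 ?ln_le0 //; lra.
Qed.

(* Gibbs' inequality against the product of [n] Bernoulli([q]) distributions. *)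
Lemma entropy_bound (n k : nat) (p : qb n -> R) (q : R) :
  (forall x, 0 <= p x) -> \sum_x p x = 1 -> (forall x, p x <= (2 ^+ k)^-1) ->
  (forall i, \sum_(x : qb n | x i) p x <= q) -> 0 <= q -> q < 1 / 2 ->
  k%:R <= n%:R * H2 q.
Proof.
move=> p0 p1 pk pq q0 q12.
have two_gt0 m : 0 < 2 ^+ m :> R by rewrite exprn_gt0.
(* For [q = 0] the reference distribution has zeros. Then [p] is concentrated on the zero string, so
   [1 <= 2 ^- k] and [k = 0]. *)
move: q0; rewrite le_eqVlt => /orP[/eqP q0|q0].
  pose z : qb n := [ffun=> false].
  have pz x : x != z -> p x = 0.
    move=> xz; have /existsP[i xi] : [exists i, x i].
      apply: contraR xz => /existsPn h; apply/eqP/ffunP => i; rewrite ffunE.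
      exact/negbTE.
    apply/eqP; rewrite eq_le p0 andbT -q0 in pq *; apply: le_trans (pq i).
    by rewrite (bigD1 x) //= lerDl sumr_ge0.
  have : 1 <= (2 ^+ k)^-1 :> R.
    by rewrite -[leLHS]p1 (bigD1 z) //= big1 ?addr0 // => x; exact: pz.
  rewrite invr_ge1 ?unitfE ?gt_eqF // ?inE ?two_gt0 //.
  case: k {pk} => [|k] h; last first.
    by move: h; rewrite leNgt exprn_egt1 ?ltr1n.
  by rewrite mulr_ge0 // -q0 H2_ge0 // q0.
pose f (b : bool) := if b then q else 1 - q.
have f0 b : 0 < f b by case: b => /=; lra.
pose r (x : qb n) := \prod_i f (x i).
have r0 x : 0 < r x by apply: prodr_gt0 => i _; exact: f0.
have r1 : \sum_x r x = 1.
  rewrite /r -(bigA_distr_bigA (fun _ : 'I_n => f)) /=.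
  by apply: big1 => i _; rewrite big_bool /=; lra.
(* Summed over [x], this says that the entropy of [p] is at least [k ln 2]. *)
have kp x : p x * (k%:R * ln 2) <= - (p x * ln (p x)).
  move: (p0 x); rewrite le_eqVlt => /orP[/eqP <-|px]; first by rewrite !mul0r oppr0.
  rewrite -mulrN ler_pM2l // -lnV ?posrE // mulr_natl -lnXn //.
  rewrite ler_ln ?posrE ?invr_gt0 //.
  by rewrite -[leLHS]invrK lef_pV2 ?posrE ?invr_gt0.
have S1 : k%:R * ln 2 <= - \sum_x p x * ln (r x).
  have -> : k%:R * ln 2 = \sum_x p x * (k%:R * ln 2) by rewrite -mulr_suml p1 mul1r.
  rewrite -subr_ge0 -opprD -big_split /= oppr_ge0.
  apply: (@le_trans _ _ (\sum_x (r x - p x))); last by rewrite sumrB r1 p1 subrr.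
  apply: ler_sum => x _; apply: le_trans (gibbs_le (p0 x) (r0 x)).
  by rewrite lerD2l.
have S2 : - \sum_x p x * ln (r x) <= n%:R * (- (q * ln q) - (1 - q) * ln (1 - q)).
  have -> : - \sum_x p x * ln (r x) = \sum_(i < n) - \sum_x p x * ln (f (x i)).
    rewrite sumrN; congr (- _); rewrite exchange_big /=; apply: eq_bigr => x _.
    by rewrite -mulr_sumr ln_prod.
  have -> : n%:R * (- (q * ln q) - (1 - q) * ln (1 - q)) =
      \sum_(i < n) (- (q * ln q) - (1 - q) * ln (1 - q)).
    by rewrite sumr_const card_ord mulr_natl.
  apply: ler_sum => i _.
  have -> : \sum_x p x * ln (f (x i)) =
      ln (1 - q) + (\sum_(x : qb n | x i) p x) * (ln q - ln (1 - q)).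
    rewrite [X in X + _](_ : _ = \sum_x p x * ln (1 - q)); last by rewrite -mulr_suml p1 mul1r.
    rewrite mulr_suml [X in _ + X]big_mkcond -big_split /=.
    by apply: eq_bigr => x _; case: (x i) => /=; lra.
  (* As [q < 1 / 2], the cross entropy grows with the marginal [t], which may therefore be replaced
     by its bound [q]. *)
  have lnq : ln q <= ln (1 - q) by rewrite ler_ln ?posrE; lra.
  have := pq i; set t := \sum_(x | _) _ => tq; nra.
have := le_trans S1 S2; rewrite -ler_pdivlMr ?ln2_gt0 // => /le_trans; apply.
by rewrite /H2 /log2 le_eqVlt; apply/orP; left; apply/eqP; field; rewrite gt_eqF ?ln2_gt0.
Qed.

End Entropy.

(** * Recovery from a replacement channel *)

Section Tensor.
Variable R : realType.
Local Notation C := (R[i]).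
Local Notation mone X := (@idm R X).

Definition tens (X Y : finType) (A : mat R X X) (B : mat R Y Y) :
  mat R (X * Y)%type (X * Y)%type := fun p q => A p.1 q.1 * B p.2 q.2.

Lemma tens_mul (X Y : finType) (A A' : mat R X X) (B B' : mat R Y Y) :
  tens A B ** tens A' B' = tens (A ** A') (B ** B').
Proof.
apply: mat_ext => p q; rewrite /mmul /tens big_distrlr /= pair_bigA /=.
by apply: eq_bigr => r _; rewrite mulrACA.
Qed.

Lemma tens_adj (X Y : finType) (A : mat R X X) (B : mat R Y Y) :
  adj (tens A B) = tens (adj A) (adj B).
Proof. by apply: mat_ext => p q; rewrite /adj /tens rmorphM. Qed.

Lemma tens_idm (X Y : finType) : tens (mone X) (mone Y) = mone (X * Y)%type.
Proof. by apply: mat_ext => -[x y] [x' y']; rewrite /tens /idm -natrM mulnb xpair_eqE. Qed.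

Definition ptrace (X Y : finType) (rho : mat R (X * Y)%type (X * Y)%type) : mat R X X :=
  fun x x' => \sum_y rho (x, y) (x', y).

Lemma sum_pair (X Y : finType) (F : X * Y -> C) : \sum_p F p = \sum_x \sum_y F (x, y).
Proof. by rewrite pair_bigA; apply: eq_bigr => -[]. Qed.

Lemma mtr_tens_ptrace (X Y : finType) (A : mat R X X) (rho : mat R (X * Y)%type (X * Y)%type) :
  mtr (tens A (mone Y) ** rho) = mtr (A ** ptrace rho).
Proof.
rewrite /mtr /mmul /ptrace /tens /idm.
rewrite sum_pair; apply: eq_bigr => x _.
under eq_bigr => y _.
  rewrite sum_pair /=; under eq_bigr => x' _.
    under eq_bigr => y' _ do rewrite -mulrA.
    rewrite -mulr_sumr sum_eq_mull.
    over.
  over.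
rewrite exchange_big /=; apply: eq_bigr => x' _; by rewrite mulr_sumr.
Qed.

(** The test vector is pushed forward along [f] by summing over fibres. An arbitrary [f] covers
    slices, reorderings of tensor factors and projections alike. *)
Lemma psd_pullback (X Y : finType) (f : X -> Y) (A : mat R Y Y) :
  psd A -> psd (fun x x' => A (f x) (f x')).
Proof.
move=> A0 v; have := A0 (fun y => \sum_x (f x == y)%:R * v x); congr (_ <= _).
have inner y : \sum_y' A y y' * (\sum_x (f x == y')%:R * v x) = \sum_x A y (f x) * v x.
  under eq_bigr do rewrite mulr_sumr.
  rewrite exchange_big; apply: eq_bigr => x _.
  by under eq_bigr do rewrite mulrCA; rewrite sum_eq_mull.
under eq_bigr => y _.
  under eq_bigr do rewrite -mulrA.
  rewrite -mulr_sumr inner rmorph_sum mulr_suml.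
  under eq_bigr do rewrite rmorphM /= rmorph_nat -mulrA.
  over.
rewrite exchange_big; apply: eq_bigr => x _ /=; rewrite sum_eq_mull mulr_sumr.
by apply: eq_bigr => x' _; rewrite mulrA.
Qed.

Lemma psd_ptrace (X Y : finType) (rho : mat R (X * Y)%type (X * Y)%type) :
  psd rho -> psd (ptrace rho).
Proof.
move=> rho0 v.
have -> : \sum_x \sum_x' Num.conj (v x) * ptrace rho x x' * v x' =
    \sum_y \sum_x \sum_x' Num.conj (v x) * rho (x, y) (x', y) * v x'.
  rewrite [RHS]exchange_big /=; apply: eq_bigr => x _; rewrite [RHS]exchange_big /=.
  by apply: eq_bigr => x' _; rewrite /ptrace mulr_sumr mulr_suml.
by apply: sumr_ge0 => y _; exact: (psd_pullback (fun x => (x, y)) rho0 v).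
Qed.

Lemma cptp_sum (X Y I : finType) (M : chan R X Y) (F : I -> mat R X X) y y' : cptp M ->
  M (fun x x' => \sum_i F i x x') y y' = \sum_i M (F i) y y'.
Proof.
move=> [Mlin _].
have M0 : M (fun _ _ => 0) y y' = 0.
  have := Mlin (-1) (fun _ _ => 0) (fun _ _ => 0) y y'.
  rewrite [X in M X](_ : _ = (fun _ _ => 0)); last first.
    by apply: mat_ext => x x'; rewrite /madd /mscale mulr0 addr0.
  by rewrite mulN1r addNr.
elim: (index_enum I) => [|i s IH].
  rewrite big_nil -[RHS]M0; congr (M _ y y'); apply: mat_ext => x x'; exact: big_nil.
rewrite big_cons -IH -[M (F i) y y']mul1r -Mlin; congr (M _ y y').
by apply: mat_ext => x x'; rewrite big_cons /madd /mscale mul1r.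
Qed.

End Tensor.

(** * Correlations with the lost block under an arbitrary recovery *)

Section Recovery.
Variable R : realType.
Local Notation C := (R[i]).
Local Notation mone X := (@idm R X).
Local Notation mzero := (fun _ _ => 0).
Variables (n k : nat).

(** The conditions in [ptr] force both configurations to differ from [x] and [x'] only on [S], and
    to carry the same filling [a] there. *)
Lemma ptr_compl (S : {set 'I_n}) (rho : mat R (qb n) (qb n)) x x' :
  ptr rho (restr (~: S)%SET x) (restr (~: S)%SET x') =
  \sum_(a : subq S) rho (glue a x) (glue a x').
Proof.
have restrC u v : (restr (~: S)%SET u == restr (~: S)%SET v) = agree S u v.
  apply/eqP/agreeP => [/restrE h i iS|h]; first by apply: h; rewrite inE.
  by apply/restrE => i; rewrite inE; exact: h.
have agreeC u v : agree (~: S)%SET u v = (restr S u == restr S v).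
  apply/agreeP/eqP => [h|/restrE h i]; last by rewrite inE negbK; exact: h.
  by apply/restrE => i iS; apply: h; rewrite inE negbK.
rewrite /ptr.
under eq_bigr => u _.
  under eq_bigr => v _.
    rewrite -/(agree (~: S)%SET u v) !restrC agreeC -mulnb natrM -mulrA -mulnb natrM -mulrA.
    over.
  rewrite -mulr_sumr sum_boolmul sum_glue.
  over.
rewrite sum_boolmul sum_glue; apply: eq_bigr => a _.
rewrite restr_glue (eq_bigr (fun b => (a == b)%:R * rho (glue a x) (glue b x'))).
  by rewrite (sum_eq_mull a (fun b => rho (glue a x) (glue b x'))).
by move=> b _; rewrite restr_glue.
Qed.

(** The block value [z] marks one representative in each class of configurations that differ only on
    [S]. *)
Lemma sum_fiber (S : {set 'I_n}) (z : subq S) (G : qb n -> C) :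
  \sum_v G v = \sum_(x | restr S x == z) \sum_(a : subq S) G (glue a x).
Proof.
rewrite (partition_big (fun v => glue z v) (fun x => restr S x == z)) /=; last first.
  by move=> v _; rewrite restr_glue.
apply: eq_bigr => x /eqP xz; rewrite -sum_glue; apply: eq_bigl => v.
apply/eqP/idP => [<-|vx]; first by rewrite agree_sym glue_agree.
rewrite -[RHS](glue_restr (agreexx S x)) xz; apply/ffunP => i.
case: (boolP (i \in S)) => iS; first by rewrite !glue_in.
by rewrite !glue_notin //; apply: (agreeP _ _ _ vx).
Qed.

Lemma glue_glue (S : {set 'I_n}) (a b : subq S) x : glue a (glue b x) = glue a x.
Proof.
apply/ffunP => i; case: (boolP (i \in S)) => iS; first by rewrite !glue_in.
by rewrite !glue_notin.
Qed.


Variables (V : mat R (qb n) (qb k)) (phi : vec R (qb k)).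
Hypotheses (V_iso : adj V ** V = mone (qb k)) (phi1 : unit_vec phi).
Variables (S : {set 'I_n}) (w : mat R (subq S) (subq S)).
Hypotheses (w_adj : adj w = w) (w_inv : w ** w = mone (subq S)).

(** The logical state, its complement, and the sign observable to be read off the reference. *)
Let Q := proj phi.
Let B := msub (mone (qb k)) Q.
Let Z := msub Q B.

Let QQ : Q ** Q = Q. Proof. exact: proj_idem. Qed.

Let QB : Q ** B = mzero.
Proof.
by rewrite /B mmulBr mmulm1 QQ; apply: mat_ext => x y; rewrite /msub subrr.
Qed.

Let BQ : B ** Q = mzero.
Proof.
by rewrite /B mmulBl mmul1m QQ; apply: mat_ext => x y; rewrite /msub subrr.
Qed.

Let BB : B ** B = B.
Proof.
rewrite {2}/B mmulBr mmulm1 BQ.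
by apply: mat_ext => x y; rewrite /msub subr0.
Qed.

Let Q_adj : adj Q = Q. Proof. exact: adj_proj. Qed.
Let B_adj : adj B = B. Proof. by rewrite adjB adj_idm Q_adj. Qed.

(** The span of [Q] and [B] is closed under products, so computations with the input reduce to two
    coefficients. *)
Definition schmidt_mx (a b : R) : mat R (qb k) (qb k) :=
  madd (mscale a%:C%C Q) (mscale b%:C%C B).

(** Vectorization of the matrix: the first index is the system, the second the reference. *)
Definition schmidt_vec (a b : R) : vec R (qb k * qb k)%type :=
  fun p => schmidt_mx a b p.1 p.2.

Lemma schmidt_mx_adj a b : adj (schmidt_mx a b) = schmidt_mx a b.
Proof. by rewrite adjD !adjZ !conj_realc Q_adj B_adj. Qed.

Lemma schmidt_mx_mul a b a' b' :
  schmidt_mx a b ** schmidt_mx a' b' = schmidt_mx (a * a') (b * b').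
Proof.
rewrite mmulDl !mmulDr !mmulZl !mmulZr QQ BB QB BQ.
by apply: mat_ext => x y; rewrite /schmidt_mx /madd /mscale !rmorphM /=; ring.
Qed.

Lemma Z_schmidt : Z = schmidt_mx 1 (-1).
Proof.
apply: mat_ext => x y; rewrite /Z /schmidt_mx /msub /madd /mscale.
by rewrite rmorphN rmorph1 mul1r mulN1r.
Qed.

Lemma mtr_schmidt a b : mtr (schmidt_mx a b) = (a + b * (2 ^+ k - 1))%:C%C.
Proof.
have tr1 : mtr (mone (qb k)) = (2 ^+ k)%:C%C.
  rewrite /mtr /idm; under eq_bigr do rewrite eqxx.
  by rewrite sumr_const card_ffun card_bool card_ord -natrX rmorph_nat.
rewrite mtrD !mtrZ mtrB tr1 mtr_proj //.
by rewrite rmorphD rmorphM rmorphB rmorph1 mulr1.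
Qed.

Variables a b : R.
(* This gives weight 1/2 to [phi] and shares the other 1/2
   evenly among the [2 ^ k - 1] remaining directions. *)
Hypotheses (a2 : a ^+ 2 = 1 / 2) (b2 : b ^+ 2 * (2 ^+ k - 1) = 1 / 2).
Local Notation M := (schmidt_mx a b).
Local Notation Omega := (schmidt_vec a b).

Lemma schmidt_unit : unit_vec Omega.
Proof.
rewrite /unit_vec sum_pair /schmidt_vec /=.
have <- : mtr (adj M ** M) = 1.
  rewrite schmidt_mx_adj schmidt_mx_mul mtr_schmidt -!expr2 b2 a2.
  by rewrite -splitr.
by rewrite exchange_big.
Qed.

Definition zero_sub : subq S := [ffun=> false].
(** A pure replacement state, so that the noise has the pure dilation [kept_vec]. *)
Definition gamma0 : mat R (subq S) (subq S) := proj (fun r => (r == zero_sub)%:R).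

Lemma density_gamma0 : density gamma0.
Proof.
split; first exact: psd_proj.
exact/mtr_proj/unit_vec_delta.
Qed.

Let theta := V ** M.

(** The encoded input with the content of [S] moved to a factor of its own and zeros left in its
    place. *)
Definition kept_vec : vec R (qb n * (qb k * subq S))%type :=
  fun p => theta (glue p.2.2 p.1) p.2.1 * (restr S p.1 == zero_sub)%:R.

Variable Rc : chan R (qb n) (qb k).
Hypothesis Rc_cptp : cptp Rc.

(* The noise hands the block [S] over to the environment: this is the joint state of the
   recovered system, the reference and that block. *)
Definition kept_state : mat R ((qb k * qb k) * subq S)%type ((qb k * qb k) * subq S)%type :=
  fun p q => ext Rc (proj kept_vec) (p.1.1, (p.1.2, p.2)) (q.1.1, (q.1.2, q.2)).

Definition noisy_recovery : chan R (qb k) (qb k) := fun rho => Rc (repl gamma0 (enc V rho)).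

Lemma psd_kept_state : psd kept_state.
Proof.
have [_ [_ Rpsd]] := Rc_cptp.
exact: (psd_pullback (fun p : (qb k * qb k) * subq S => (p.1.1, (p.1.2, p.2)))
  (Rpsd _ _ (psd_proj kept_vec))).
Qed.

Lemma enc_slice l l' x x' :
  enc V (fun m m' => proj Omega (m, l) (m', l')) x x' = theta x l * Num.conj (theta x' l').
Proof.
rewrite /enc /theta /mmul /proj /schmidt_vec /adj /= rmorph_sum mulr_sumr.
apply: eq_bigr => m' _; rewrite !mulr_suml; apply: eq_bigr => m _.
by rewrite rmorphM /=; ring.
Qed.

(** Discarding the retained block restores the replacement noise; linearity of [Rc] takes the sum
    over the block inside. *)
Lemma ptrace_kept_state : ptrace kept_state = ext noisy_recovery (proj Omega).
Proof.
apply: mat_ext => -[m l] [m' l']; rewrite /ptrace /kept_state /ext /= -cptp_sum //.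
rewrite /noisy_recovery; congr (Rc _ m m'); apply: mat_ext => x x'.
rewrite /repl ptr_compl mulr_suml; apply: eq_bigr => r _.
by rewrite enc_slice /gamma0 /proj /kept_vec /= rmorphM /=; ring.
Qed.

Lemma kept_vec_gram (v : mat R (subq S) (subq S)) l l' :
  (adj theta ** (embed v ** theta)) l l' =
  \sum_r \sum_r' v r r' * \sum_x proj kept_vec (x, (l', r')) (x, (l, r)).
Proof.
have inner y : (embed v ** theta) y l' = \sum_r' v (restr S y) r' * theta (glue r' y) l'.
  rewrite /mmul /embed; under eq_bigr do rewrite -mulrA agree_sym.
  by rewrite sum_boolmul sum_glue; apply: eq_bigr => r' _; rewrite restr_glue.
rewrite {1}/mmul; under eq_bigr do rewrite inner.
rewrite (sum_fiber zero_sub) -sum_boolmul.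
under [RHS]eq_bigr => r _.
  under eq_bigr => r' _ do rewrite mulr_sumr.
  rewrite exchange_big /=.
  over.
rewrite [RHS]exchange_big /=; apply: eq_bigr => x _; rewrite mulr_sumr.
apply: eq_bigr => r _; rewrite restr_glue !mulr_sumr; apply: eq_bigr => r' _.
rewrite glue_glue /proj /kept_vec /adj /= rmorphM /= rmorph_nat.
by case: (restr S x == _); rewrite ?mul1r ?mulr1 ?mul0r ?mulr0 //; ring.
Qed.

(** [Rc] preserves traces, so observables on the reference and the block do not see it. The
    transpose appears because acting on the reference of a vectorized matrix is multiplication from
    the right. *)
Lemma mtr_kept_state (Y : mat R (qb k) (qb k)) (v : mat R (subq S) (subq S)) :
  mtr (tens (tens (mone (qb k)) (fun l l' => Y l' l)) v ** kept_state) =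
  mtr (embed v ** theta ** Y ** adj theta).
Proof.
have -> : mtr (embed v ** theta ** Y ** adj theta) = mtr (adj theta ** (embed v ** theta) ** Y).
  by rewrite [LHS]mtrC mmulA.
have slice l l' r r' : \sum_m kept_state ((m, l'), r') ((m, l), r) =
    \sum_x proj kept_vec (x, (l', r')) (x, (l, r)).
  have [_ [Rtr _]] := Rc_cptp.
  exact: (Rtr (fun x x' => proj kept_vec (x, (l', r')) (x', (l, r)))).
have entry m l r : (tens (tens (mone (qb k)) (fun l l' => Y l' l)) v ** kept_state)
      ((m, l), r) ((m, l), r) =
    \sum_l' \sum_r' Y l' l * v r r' * kept_state ((m, l'), r') ((m, l), r).
  rewrite /mmul !sum_pair /tens /idm /=.
  rewrite (eq_bigr (fun m' => (m == m')%:R *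
    \sum_l' \sum_r' Y l' l * v r r' * kept_state ((m', l'), r') ((m, l), r))).
    by rewrite sum_eq_mull.
  move=> m' _; rewrite mulr_sumr; apply: eq_bigr => l' _; rewrite mulr_sumr.
  by apply: eq_bigr => r' _; rewrite !mulrA.
rewrite /mtr !sum_pair exchange_big /=; apply: eq_bigr => l _.
rewrite [RHS]/mmul.
under eq_bigr => m _.
  under eq_bigr => r _ do rewrite entry.
  rewrite exchange_big /=.
  over.
rewrite exchange_big /=; apply: eq_bigr => l' _.
rewrite -/(mmul _ _ _ _) kept_vec_gram mulr_suml exchange_big /=; apply: eq_bigr => r _.
rewrite mulr_suml exchange_big /=; apply: eq_bigr => r' _.
by rewrite -mulr_sumr slice; ring.
Qed.

(** Fidelity on the single input [Omega] bounds the weight of [kept_state] off [Omega], and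
    [decoupling] turns this into a bound on the correlation of [Z] on the reference with [w] on the
    lost block. *)
Lemma recovery_bound :
  Re (mtr (embed w ** msub (proj (mapply V phi)) (Gam V))) <=
  4 * pdist noisy_recovery (fun rho => rho).
Proof.
set c := Re (mtr (ptrace kept_state ** proj Omega)).
have fid_c : fid (ext noisy_recovery (proj Omega)) (ext (fun rho => rho) (proj Omega)) ^+ 2 <= c.
  have -> : ext (fun rho => rho) (proj Omega) = proj Omega.
    by apply: mat_ext => -[m l] [m' l'].
  rewrite -ptrace_kept_state; apply: fid_proj_le schmidt_unit.
  exact: psd_ptrace psd_kept_state.
have pd : Num.sqrt (1 - c) <= pdist noisy_recovery (fun rho => rho).
  rewrite /pdist ler_wsqrtr // lerB // (le_trans _ fid_c) //.
  rewrite /chan_fid; set A := (X in inf X ^+ 2 <= _).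
  have A_lb : lbound A 0 by move=> _ [rho _ <-]; exact: fid_ge0.
  have A_in : A (fid (ext noisy_recovery (proj Omega)) (ext (fun rho => rho) (proj Omega))).
    exists (proj Omega) => //; split; first exact: psd_proj.
    exact: mtr_proj schmidt_unit.
  rewrite ler_pXn2r ?nnegrE ?fid_ge0 //; first by apply: ge_inf => //; exists 0.
  by apply: lb_le_inf => //; eexists; exact: A_in.
pose T := tens (tens (mone (qb k)) (fun l l' => Z l' l)) w.
have ZT (A : mat R (qb k) (qb k)) : adj A = A -> adj (fun l l' => A l' l) = (fun l l' => A l' l).
  by move=> AA; apply: mat_ext => l l'; rewrite -[in RHS]AA.
have Z_adj : adj Z = Z by rewrite Z_schmidt schmidt_mx_adj.
have ZZ : Z ** Z = mone (qb k).
  rewrite !Z_schmidt schmidt_mx_mul mulr1 mulrNN mulr1.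
  by apply: mat_ext => x y; rewrite /schmidt_mx /madd /mscale rmorph1 !mul1r /B /msub addrC subrK.
have T_adj : adj T = T by rewrite /T !tens_adj adj_idm ZT // w_adj.
have TT : T ** T = mone _.
  rewrite /T !tens_mul mmul1m w_inv.
  rewrite (_ : (fun l l' => Z l' l) ** (fun l l' => Z l' l) = mone (qb k)) ?tens_idm //.
  apply: mat_ext => l l'; rewrite /idm eq_sym -[RHS]/(mone (qb k) l' l) -ZZ /mmul.
  by apply: eq_bigr => m _; rewrite mulrC.
pose P := tens (proj Omega) (mone (subq S)).
have P_adj : adj P = P by rewrite /P tens_adj adj_proj adj_idm.
have PP : P ** P = P by rewrite /P tens_mul proj_idem ?mmul1m //; exact: schmidt_unit.
(* The two halves of the Schmidt weight are equal, so [Z] has mean zero in [Omega]; this is what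
   makes [P ** T ** P] vanish. *)
have Omega_Z : mtr (tens (mone (qb k)) (fun l l' => Z l' l) ** proj Omega) = 0.
  have -> : mtr (tens (mone (qb k)) (fun l l' => Z l' l) ** proj Omega) = mtr (adj M ** M ** Z).
    rewrite mtr_proj_mul sum_pair exchange_big /mtr; apply: eq_bigr => l _ /=.
    rewrite -mmulA {1}/mmul; apply: eq_bigr => m _.
    rewrite sum_pair /mmul mulr_sumr exchange_big; apply: eq_bigr => l' _ /=.
    rewrite (eq_bigr (fun m' => (m == m')%:R * (Num.conj (M m l) * (M m' l' * Z l' l)))).
      by rewrite (sum_eq_mull m (fun m' => Num.conj (M m l) * (M m' l' * Z l' l))).
    by move=> m' _; rewrite /tens /idm /schmidt_vec /=; ring.
  rewrite schmidt_mx_adj Z_schmidt !schmidt_mx_mul mtr_schmidt mulr1 mulrN1 mulNr -!expr2 b2 a2.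
  by rewrite subrr.
have PTP : P ** T ** P = mzero.
  rewrite /P /T !tens_mul proj_sandwich Omega_Z.
  by apply: mat_ext => p q; rewrite /tens /mscale !mul0r.
have tau1 : mtr kept_state = 1.
  have := mtr_kept_state (mone (qb k)) (mone (subq S)).
  rewrite (_ : (fun l l' => idm R l' l) = mone (qb k)); last first.
    by apply: mat_ext => l l'; rewrite /idm eq_sym.
  rewrite !tens_idm mmul1m embed_idm mmul1m mmulm1 => ->.
  rewrite mtrC /theta adjM -mmulA (mmulA (adj V)) V_iso mmul1m.
  rewrite schmidt_mx_adj schmidt_mx_mul mtr_schmidt -!expr2 b2 a2.
  by rewrite -splitr.
have := decoupling psd_kept_state tau1 T_adj TT P_adj PP PTP.
rewrite /P mtr_tens_ptrace [mtr (proj _ ** _)]mtrC -/c /T mtr_kept_state.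
set D : R := 2 ^+ k; set g := Re (mtr (embed w ** msub _ _)).
have -> : Re (mtr (embed w ** theta ** Z ** adj theta)) = (1 / 2 + b ^+ 2) * g.
  have -> : embed w ** theta ** Z ** adj theta = embed w ** (V ** schmidt_mx (a * a) (- (b * b)) ** adj V).
    rewrite /theta adjM schmidt_mx_adj Z_schmidt -!mmulA; congr (_ ** (_ ** _)).
    by rewrite !(mmulA M) schmidt_mx_mul mmulA schmidt_mx_mul !mulr1 mulrN1 mulNr.
  have D0 : D != 0 by rewrite expf_neq0.
  (* From [b2], [b ^ 2 = (1 / 2 + b ^ 2) / 2 ^ k]. Hence [a ^ 2 Q - b ^ 2 B] is encoded to a
     multiple of the difference of the code state and [Gam]. *)
  have -> : V ** schmidt_mx (a * a) (- (b * b)) ** adj V =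
      mscale (1 / 2 + b ^+ 2)%:C%C (msub (proj (mapply V phi)) (Gam V)).
    rewrite proj_mapply.
    have DC : (2 ^+ k)^-1 = (D^-1)%:C%C :> C.
      by rewrite /D fmorphV rmorphXn rmorph_nat.
    rewrite /Gam /schmidt_mx /B DC mmulDr mmulDl !(mmulZr, mmulZl, mmulBr, mmulBl, mmulm1).
    have bD : (1 / 2 + b ^+ 2) * D^-1 = b * b.
      rewrite -b2 -/D; by field.
    have bDC : (1 / 2 + b ^+ 2)%:C%C * (D^-1)%:C%C = (b * b)%:C%C :> C by rewrite -rmorphM bD.
    apply: mat_ext => x y; rewrite /madd /mscale /msub [RHS]mulrBr [in RHS]mulrA bDC.
    by rewrite -a2 rmorphN rmorphD !rmorphXn !rmorphM /=; ring.
  by rewrite mmulZr mtrZ ReZ.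
have s0 : 0 <= Num.sqrt (1 - c) by exact: sqrtr_ge0.
(* For positive [g] the term [b ^ 2 * g] is dropped; the remaining factor [1 / 2] turns the 2 of
   [decoupling] into 4. *)
move=> h; have [g0|g0] := leP g 0; first by apply: le_trans g0 _; lra.
have : 0 <= b ^+ 2 * g by rewrite mulr_ge0 ?sqr_ge0 // ltW.
lra.
Qed.

End Recovery.

(** * Local distinguishability of code states *)

Section CodeBounds.
Variable R : realType.
Local Notation C := (R[i]).
Local Notation mone X := (@idm R X).
Variables (n k : nat) (V : mat R (qb n) (qb k)).
Hypothesis V_iso : adj V ** V = mone (qb k).

Lemma ptrB (S : {set 'I_n}) (A B : mat R (qb n) (qb n)) :
  ptr (S := S) (msub A B) = msub (ptr A) (ptr B).
Proof.
apply: mat_ext => r r'; rewrite /ptr /msub -sumrB; apply: eq_bigr => x _.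
by rewrite -sumrB; apply: eq_bigr => y _; rewrite mulrBr.
Qed.

Lemma mtr_code_state psi : code_state V psi -> mtr (proj psi) = 1.
Proof.
move=> [phi [phi1 ->]]; rewrite proj_mapply mtrC mmulA V_iso mmul1m.
exact: mtr_proj.
Qed.

Lemma mtr_idm_qb m : mtr (mone (qb m)) = 2 ^+ m.
Proof.
rewrite /mtr /idm; under eq_bigr do rewrite eqxx.
by rewrite sumr_const card_ffun card_bool card_ord -natrX.
Qed.

Lemma mtr_Gam : mtr (Gam V) = 1.
Proof. by rewrite mtrZ mtrC V_iso mtr_idm_qb mulVf // expf_neq0. Qed.

Lemma code_state_norm_le1 psi x : code_state V psi -> `|psi x| <= 1.
Proof.
move=> /mtr_code_state; rewrite /mtr (bigD1 x) //= => psi1.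
rewrite -(@expr_le1 _ 2) // normCK -psi1 lerDl; apply: sumr_ge0 => y _.
exact: mul_conjC_ge0.
Qed.

(** A [sup] dominates its elements only when the set is bounded. Entries of the reduced differences
    are at most [K], because amplitudes have modulus at most 1, and summing over all [S] makes the
    bound uniform. *)
Lemma eps_g_has_ubound d : has_ubound [set r : R | exists (psi : vec R (qb n)) (S : {set 'I_n}),
  code_state V psi /\ (#|S| <= d)%N /\
  r = trnorm (msub (ptr (S := S) (proj psi)) (ptr (Gam V)))]%classic.
Proof.
pose K : C := \sum_x \sum_y (1 + `|Gam V x y|).
have K0 : 0 <= K by apply: sumr_ge0 => x _; apply: sumr_ge0 => y _; rewrite addr_ge0.
pose F (S : {set 'I_n}) : R := #|{: subq S}|%:R + \sum_(r : subq S) \sum_(r' : subq S) Re (K ^+ 2).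
have F0 S : 0 <= F S.
  rewrite addr_ge0 //; apply: sumr_ge0 => r _; apply: sumr_ge0 => r' _.
  by apply: Re_ge0; rewrite exprn_ge0.
exists (\sum_S F S) => _ [psi [S [psiV [_ ->]]]].
apply: (@le_trans _ _ (F S)); last by rewrite (bigD1 S) //= lerDl sumr_ge0.
apply: le_trans (trnorm_le _) _; rewrite lerD2l.
apply: ler_sum => r _; apply: ler_sum => r' _.
have : `|msub (ptr (S := S) (proj psi)) (ptr (Gam V)) r r'| ^+ 2 <= K ^+ 2.
  rewrite ler_pXn2r ?nnegrE // -ptrB /ptr.
  apply: le_trans (ler_norm_sum _ _ _) _; apply: ler_sum => x _.
  apply: le_trans (ler_norm_sum _ _ _) _; apply: ler_sum => y _.
  rewrite normrM; apply: (@le_trans _ _ `|msub (proj psi) (Gam V) x y|).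
    by rewrite ler_piMl // normr_nat; case: (X in (nat_of_bool X)%:R).
  rewrite /msub; apply: le_trans (ler_normB _ _) _; rewrite lerD2r /proj normrM norm_conjC.
  by rewrite -[leRHS]mulr1 ler_pM // code_state_norm_le1.
by rewrite lecE => /andP[].
Qed.

Lemma eps_g_bound d psi (S : {set 'I_n}) (w : mat R (subq S) (subq S)) :
  code_state V psi -> (#|S| <= d)%N -> w ** adj w = mone (subq S) ->
  Re (mtr (embed w ** msub (proj psi) (Gam V))) <= eps_g V d.
Proof.
move=> psiV Sd ww; rewrite mtr_embed_mul ptrB; apply: le_trans (trnorm_dual _ ww) _.
by apply: (ub_le_sup (eps_g_has_ubound d)); exists psi, S.
Qed.

Lemma psd_schur (X : finType) (u : vec R X) (A : mat R X X) :
  psd A -> psd (fun x y => u x * A x y * Num.conj (u y)).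
Proof.
move=> A0 v; have := A0 (fun x => Num.conj (u x) * v x); congr (_ <= _).
apply: eq_bigr => x _; apply: eq_bigr => y _; rewrite rmorphM /= conjCK; ring.
Qed.

(** Keeps the infimum over recoveries from ranging over the empty set. The channel discards its
    input and prepares [y0]. *)
Lemma cptp_ex (X Y : finType) (y0 : Y) : exists M : chan R X Y, cptp M.
Proof.
pose u : vec R Y := fun y => (y == y0)%:R.
have u1 : mtr (proj u) = 1 by exact/mtr_proj/unit_vec_delta.
exists (fun rho => mscale (mtr rho) (proj u)); split; [|split].
- by move=> c A B y y'; rewrite /mscale mtrD mtrZ mulrDl mulrA.
- by move=> A; rewrite mtrZ u1 mulr1.
move=> Z rho rho0.
have := psd_schur (fun p : Y * Z => u p.1) (psd_pullback (fun p : Y * Z => p.2)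
  (psd_ptrace (psd_pullback (fun p : Z * X => (p.2, p.1)) rho0))).
congr psd; apply: mat_ext => p q; rewrite /ext /mscale /mtr /proj /ptrace /=; ring.
Qed.

Lemma pdist_ge0 (X Y : finType) (M M' : chan R X Y) : 0 <= pdist M M'.
Proof. exact: sqrtr_ge0. Qed.

Lemma pdist_le1 (X Y : finType) (M M' : chan R X Y) : pdist M M' <= 1.
Proof.
by rewrite /pdist -[leRHS]sqrtr1 ler_wsqrtr // lerBlDr lerDl sqr_ge0.
Qed.

Lemma qec_inacc_lb (S : {set 'I_n}) (gamma : mat R (subq S) (subq S)) (t : R) :
  (forall Rc, cptp Rc -> t <= pdist (fun rho => Rc (repl gamma (enc V rho))) (fun rho => rho)) ->
  t <= qec_inacc (repl gamma) (enc V).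
Proof.
move=> h; apply: lb_le_inf; last by move=> _ [Rc /h hRc <-].
have [Rc Rc_cptp] := cptp_ex (qb n) ([ffun=> false] : qb k).
by eexists; exists Rc.
Qed.

Lemma qec_inacc_le1 (S : {set 'I_n}) (gamma : mat R (subq S) (subq S)) :
  qec_inacc (repl gamma) (enc V) <= 1.
Proof.
have [Rc Rc_cptp] := cptp_ex (qb n) ([ffun=> false] : qb k).
apply: le_trans (pdist_le1 (fun rho => Rc (repl gamma (enc V rho))) (fun rho => rho)).
by apply: ge_inf; [exists 0 => _ [Rc' _ <-]; exact: pdist_ge0|exists Rc].
Qed.

Lemma qec_inacc_le_max d (S : {set 'I_n}) (gamma : mat R (subq S) (subq S)) :
  (#|S| <= d)%N -> density gamma ->
  qec_inacc (repl gamma) (enc V) <= max_repl_inacc V d.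
Proof.
move=> Sd gamma1; apply: ub_le_sup; last by exists S, gamma.
by exists 1 => _ [S' [gamma' [_ [_ ->]]]]; exact: qec_inacc_le1.
Qed.

Lemma max_repl_inacc_ge0 d : 0 <= max_repl_inacc V d.
Proof.
apply: le_trans (qec_inacc_le_max (S := finset.set0) _ (density_gamma0 _ _)).
  by apply: qec_inacc_lb => Rc _; exact: pdist_ge0.
by rewrite cards0.
Qed.

Lemma max_repl_inacc_bound d psi (S : {set 'I_n}) (w : mat R (subq S) (subq S)) :
  (0 < k)%N -> code_state V psi -> (#|S| <= d)%N -> adj w = w -> w ** w = mone (subq S) ->
  Re (mtr (embed w ** msub (proj psi) (Gam V))) <= 4 * max_repl_inacc V d.
Proof.
move=> k0 [phi [phi1 ->]] Sd wa ww; set t := Re _.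
suff : t / 4 <= max_repl_inacc V d by lra.
apply: le_trans (qec_inacc_le_max Sd (density_gamma0 _ _)).
apply: qec_inacc_lb => Rc Rc_cptp.
(* As [0 < k], the complement of [phi] is nonzero and half the weight can be spread over its
   [2 ^ k - 1] directions. *)
have D1 : 1 < 2 ^+ k :> R by rewrite exprn_egt1 ?ltr1n // -lt0n.
have a2 : Num.sqrt (1 / 2) ^+ 2 = 1 / 2 :> R by rewrite sqr_sqrtr //; lra.
have b2 : Num.sqrt ((2 ^+ k - 1)^-1 / 2) ^+ 2 * (2 ^+ k - 1) = 1 / 2 :> R.
  rewrite sqr_sqrtr; first by field; rewrite gt_eqF // subr_gt0.
  by rewrite divr_ge0 // invr_ge0 subr_ge0 ltW.
have := recovery_bound V_iso phi1 wa ww a2 b2 Rc_cptp.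
rewrite -/t /noisy_recovery; lra.
Qed.

End CodeBounds.

(** * Shallow circuits *)

Section Main.
Variable R : realType.
Local Notation C := (R[i]).
Local Notation mone X := (@idm R X).
Variables (n k : nat) (V : mat R (qb n) (qb k)).
Hypothesis V_iso : adj V ** V = mone (qb k).

Definition pauliZ (i : 'I_n) : mat R (qb n) (qb n) := diagm (fun x : qb n => (-1) ^+ x i).

Lemma pauliZ_adj i : adj (pauliZ i) = pauliZ i.
Proof. exact: adj_diagm. Qed.

Lemma pauliZ_inv i : pauliZ i ** pauliZ i = mone (qb n).
Proof.
rewrite diagmM; apply: mat_ext => x y; rewrite /diagm /idm -expr2 sqrr_sign.
by rewrite rmorph1 mul1r.
Qed.

Lemma supported_pauliZ i : supported [set i]%SET (pauliZ i).
Proof.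
split=> [x y xy|x y x' y' xy xy' /restrE xx /restrE yy]; rewrite /pauliZ /diagm.
  by case: eqP xy => [->|_ _]; rewrite ?agreexx ?mulr0.
have ii : i \in [set i]%SET by rewrite finset.inE.
have eqi u v : agree [set i]%SET u v -> (u == v) = (u i == v i).
  move=> /agreeP uv; apply/eqP/eqP => [->//|uvi]; apply/ffunP => j.
  by have [->//|ji] := eqVneq j i; apply: uv; rewrite finset.inE.
by rewrite !eqi // xx // yy.
Qed.

(** [A ** adj A] is a projection, so the square of a diagonal entry is at most the entry itself. *)
Lemma isometry_diag_le1 (A : mat R (qb n) (qb k)) x :
  adj A ** A = mone (qb k) -> Re ((A ** adj A) x x) <= 1.
Proof.
move=> AA; have E0 : 0 <= (A ** adj A) x x.
  by have := gram_diag_ge0 (adj A) x; rewrite adjK.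
have EE : A ** adj A ** (A ** adj A) = A ** adj A.
  by rewrite -mmulA (mmulA (adj A)) AA mmul1m.
have := hermitian_sqr_diag _ E0; rewrite EE adjM adjK => /(_ erefl).
have := Re_ge0 E0; nra.
Qed.

(* Measuring the rotated code projector in the computational basis gives a distribution
   bounded by [2 ^- k] whose marginals are controlled through the light cones. *)
Lemma shallow_circuit_bound (c : seq (mat R (qb n) (qb n))) (d : nat) (delta e : R) psi :
  code_state V psi -> (forall L, L \in c -> is_layer L) -> (2 ^ size c <= d)%N ->
  trnorm (msub (proj (run c)) (proj psi)) <= delta ->
  (forall (S : {set 'I_n}) (w : mat R (subq S) (subq S)),
     (#|S| <= d)%N -> adj w = w -> w ** w = mone (subq S) ->
     Re (mtr (embed w ** msub (proj psi) (Gam V))) <= 2 * e) ->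
  0 <= e + delta / 2 -> e + delta / 2 < 1 / 2 ->
  k%:R <= n%:R * H2 (e + delta / 2).
Proof.
move=> psiV layers cd near local_bound q0 q1.
have [[UU UaU] cone] := circuit_light_cone layers.
have runE := run_circuit_op c.
move: (circuit_op c) => U in UU UaU cone runE.
pose A := adj U ** V.
have AA : adj A ** A = mone (qb k).
  by rewrite /A adjM adjK -mmulA (mmulA U) UU mmul1m.
pose E := A ** adj A.
pose p x := (2 ^+ k)^-1 * Re (E x x).
have two_gt0 : 0 < 2 ^+ k :> R by rewrite exprn_gt0.
have trE : mtr E = (2 ^+ k)%:C%C.
  by rewrite mtrC AA mtr_idm_qb rmorphXn rmorph_nat.
have p1 : \sum_x p x = 1.
  by rewrite -mulr_sumr -Re_sum -/(mtr E) trE /= mulVf ?gt_eqF.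
apply: (@entropy_bound _ n k p) => // [x|x|i].
- apply: mulr_ge0; [by rewrite invr_ge0 ltW|apply: Re_ge0].
  by have := gram_diag_ge0 (adj A) x; rewrite adjK.
- by rewrite ler_piMr ?invr_ge0 ?(ltW two_gt0) // isometry_diag_le1.
have [S [Sc sW]] := cone _ _ (supported_pauliZ i).
set W := U ** pauliZ i ** adj U in sW.
have W_adj : adj W = W by rewrite /W !adjM adjK pauliZ_adj mmulA.
have WW : W ** W = mone (qb n).
  rewrite /W -!mmulA (mmulA (adj U)) UaU mmul1m (mmulA (pauliZ i)) pauliZ_inv mmul1m.
  exact: UU.
have [w Ww] := supported_embedP sW.
have wa : adj w = w by apply: embed_inj; rewrite embed_adj -Ww.
have ww : w ** w = mone (subq S) by apply: embed_inj; rewrite embed_mul -Ww embed_idm.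
have Sd : (#|S| <= d)%N by apply: leq_trans cd; rewrite cards1 muln1 in Sc.
have h1 := local_bound S w Sd wa ww; rewrite -Ww in h1.
have h2 : Re (mtr (W ** msub (proj (run c)) (proj psi))) <= delta.
  by apply: le_trans near; apply: trnorm_dual; rewrite W_adj.
(* Undoing [U] leaves the expectation of [pauliZ i] in the zero state, which it fixes. *)
have h3 : mtr (W ** proj (run c)) = 1.
  rewrite runE proj_mapply /W -!mmulA (mmulA (adj U)) UaU mmul1m mtrC -!mmulA UaU mmulm1.
  rewrite mtr_proj_mul /pauliZ /diagm.
  rewrite -[RHS](unit_vec_delta _ ([ffun=> false] : qb n)) /unit_vec.
  apply: eq_bigr => x _; rewrite (bigD1 x) //= big1 ?addr0 => [|y yx]; last first.
    by rewrite eq_sym (negPf yx) !mulr0 mul0r.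
  rewrite eqxx mulr1 /zero_state; case: eqP => [->|_]; last by rewrite !mulr0.
  by rewrite ffunE expr0 rmorph1 !mulr1.
have h4 : Re (mtr (W ** Gam V)) = 1 - 2 * \sum_(x : qb n | x i) p x.
  have -> : mtr (W ** Gam V) = ((2 ^+ k)^-1)%:C%C * mtr (pauliZ i ** E).
    rewrite /Gam mmulZr mtrZ fmorphV rmorphXn rmorph_nat; congr (_ * _).
    by rewrite /W /E /A adjM adjK -!mmulA mtrC -!mmulA.
  rewrite ReZ /mtr Re_sum mulr_sumr -[X in _ = X - _]p1 [X in 2 * X]big_mkcond mulr_sumr -sumrB.
  apply: eq_bigr => x _.
  have -> : Re ((pauliZ i ** E) x x) = (-1) ^+ x i * Re (E x x).
    rewrite /mmul /pauliZ /diagm.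
    under eq_bigr do rewrite -mulrA.
    by rewrite -mulr_sumr sum_eq_mull ReZ.
  by rewrite /p; case: (x i); rewrite ?expr1 ?expr0; lra.
(* Adding the two bounds: twice the marginal at [i] is at most [2 * e + delta]. *)
move: h1 h2; rewrite !mmulBr !mtrB !ReB h3 h4 /=; lra.
Qed.

End Main.

(** * From the entropy bound to circuit depth *)

Theorem theorem3 (R : realType) (n k : nat) (V : mat R (qb n) (qb k))
  (d : nat) (delta : R) :
  (k < n)%N -> qisometry V -> (1 <= d)%N -> 0 <= delta ->
  ((eps_g V d / 2 + delta / 2 < 1 / 2 /\
      H2 (eps_g V d / 2 + delta / 2) < k%:R / n%:R)
   \/
   (2 * max_repl_inacc V d + delta / 2 < 1 / 2 /\
      H2 (2 * max_repl_inacc V d + delta / 2) < k%:R / n%:R)) ->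
  forall psi : vec R (qb n), code_state V psi ->
    ((log2 (d%:R : R))%:E < circ_cplx delta psi)%E.
Proof.
move=> kn /qisometryE V_iso d1 delta0 hyp psi psiV.
have n0 : 0 < n%:R :> R by rewrite ltr0n (leq_ltn_trans _ kn).
(* Both hypotheses are brought to one bound on local reflections, with [e] equal to [eps_g V d / 2]
   or to [2 * max_repl_inacc V d]. *)
have [e [local_bound q0 q1 Hq]] : exists e : R,
    [/\ forall (S : {set 'I_n}) (w : mat R (subq S) (subq S)),
          (#|S| <= d)%N -> adj w = w -> w ** w = idm R (X := subq S) ->
          Re (mtr (embed w ** msub (proj psi) (Gam V))) <= 2 * e,
        0 <= e + delta / 2, e + delta / 2 < 1 / 2 & H2 (e + delta / 2) < k%:R / n%:R].
  case: hyp => -[q1 Hq].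
    exists (eps_g V d / 2).
    have bound (S : {set 'I_n}) (w : mat R (subq S) (subq S)) :
        (#|S| <= d)%N -> adj w = w -> w ** w = idm R (X := subq S) ->
        Re (mtr (embed w ** msub (proj psi) (Gam V))) <= 2 * (eps_g V d / 2).
      move=> Sd wa ww; rewrite mulrC divfK //; apply: eps_g_bound => //.
      by rewrite wa.
    (* The identity on the empty block shows that [eps_g V d] is nonnegative. *)
    split=> //; have := bound finset.set0 (idm R (X := subq finset.set0)).
    rewrite cards0 adj_idm mmul1m embed_idm mmul1m mtrB (mtr_code_state V_iso) // mtr_Gam // subrr /=.
    by move=> /(_ isT erefl erefl); lra.
  have m0 := max_repl_inacc_ge0 V d.
  have q0 : 0 <= 2 * max_repl_inacc V d + delta / 2 by lra.
  exists (2 * max_repl_inacc V d); split=> // S w Sd wa ww.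
  (* Entropy is nonnegative, so the strict inequality in the hypothesis excludes [k = 0]. *)
  have k0 : (0 < k)%N.
    have := le_lt_trans (H2_ge0 q0 q1) Hq.
    by rewrite pmulr_lgt0 ?invr_gt0 // ltr0n.
  by rewrite mulrA -natrM; apply: max_repl_inacc_bound.
have depth c : (forall L, L \in c -> is_layer L) ->
    trnorm (msub (proj (run c)) (proj psi)) <= delta -> (d < 2 ^ size c)%N.
  move=> layers near; rewrite ltnNge; apply/negP => cd.
  have := shallow_circuit_bound V_iso psiV layers cd near local_bound q0 q1.
  by rewrite leNgt mulrC -ltr_pdivlMr // Hq.
(* Depths are integers, so every admissible one is at least [t + 1], where [t] is the integer part
   of [log d]. This gap keeps the inequality strict after passing to the infimum. *)
pose t := trunc_log 2 d.
apply: (@lt_le_trans _ _ (t.+1%:R)%:E).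
  rewrite lte_fin /log2 ltr_pdivrMr ?ln2_gt0 // mulr_natl -lnXn // ltr_ln ?posrE ?ltr0n ?exprn_gt0 //.
  by rewrite -natrX ltr_nat trunc_log_ltn.
apply: le_ereal_inf_tmp => _ [c [layers near] <-]; rewrite lee_fin ler_nat.
rewrite -(@ltn_exp2l 2) //; apply: leq_ltn_trans (depth c layers near).
exact: trunc_logP.
Qed.
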